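(* Let $K,M,N$, $n_1,\dots,n_K$, $\tilde n_1,\dots,\tilde n_M$ be positive integers, $\mathbf H_k\in\mathbb C^{n_k\times N}$ ($1\le k\le K$), $\mathbf G_m\in\mathbb C^{\tilde n_m\times N}$ ($1\le m\le M$), $P_1,\dots,P_N>0$, $I_1,\dots,I_M>0$ and $P>0$. Assume the stacked matrix $[\mathbf H_1^T\ \cdots\ \mathbf H_K^T]^T$ has full row rank $\sum_{k}n_k\le N$. Let $\bar n_k$, $\bar{\mathbf V}_k$, $\tilde{\mathbf H}_k$, $\tilde{\mathbf G}_{mk}$, $\boldsymbol\Lambda=\boldsymbol\Lambda(\boldsymbol\psi)$, $\boldsymbol\Omega_k=\boldsymbol\Omega_k(\boldsymbol\psi)$ and $\mathbf p$ be as defined in the context. Consider the following two problems. (A) Maximize over Hermitian $\mathbf S_k\in\mathbb C^{\bar n_k\times\bar n_k}$, $\mathbf S_k\succeq\mathbf 0$, $k=1,\dots,K$, the function $$\sum_{k=1}^K\log\bigl|\mathbf I+\tilde{\mathbf H}_k\mathbf S_k\tilde{\mathbf H}_k^H\bigr|$$ subject to $$\sum_{k=1}^K[\bar{\mathbf V}_k\mathbf S_k\bar{\mathbf V}_k^H]_{n,n}\le P_n\ (1\le n\le N),\qquad \sum_{k=1}^K\operatorname{tr}(\tilde{\mathbf G}_{mk}\mathbf S_k\tilde{\mathbf G}_{mk}^H)\le I_m\ (1\le m\le M),\qquad \operatorname{rank}(\mathbf S_k)\le n_k\ (1\le k\le K).$$ (B) The minimax problem $$\min_{\boldsymbol\psi\ge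 0}\ \max_{\{\mathbf Q_k\}\succeq\mathbf 0}\ \tilde f(\boldsymbol\psi,\{\mathbf Q_k\}):=\sum_{k=1}^K\log\frac{\bigl|\bar{\mathbf V}_k^H\boldsymbol\Lambda\bar{\mathbf V}_k+\tilde{\mathbf H}_k^H\mathbf Q_k\tilde{\mathbf H}_k\bigr|}{\bigl|\bar{\mathbf V}_k^H\boldsymbol\Lambda\bar{\mathbf V}_k\bigr|}\quad\text{subject to}\quad \sum_{k=1}^K\operatorname{tr}(\mathbf Q_k)\le P,\qquad \mathbf p^T\boldsymbol\psi\le P,$$ where $\mathbf Q_k\in\mathbb C^{n_k\times n_k}$ is Hermitian and $\boldsymbol\psi\in\mathbb R^{N+M}$ ranges over vectors with nonnegative entries for which $\boldsymbol\Omega_k=\bar{\mathbf V}_k^H\boldsymbol\Lambda\bar{\mathbf V}_k$ is invertible for every $k$. Then $\tilde f$ is convex in $\boldsymbol\psi$ for fixed $\{\mathbf Q_k\}$ and concave in $\{\mathbf Q_k\}$ for fixed $\boldsymbol\psi$. Moreover, let $(\boldsymbol\psi,\{\mathbf Q_k\})$ be an optimal solution (saddle point) of (B), and for each $k$ let $\mathbf U_k\mathbf D_k\mathbf V_k^H$ be a singular value decomposition of $\tilde{\mathbf H}_k\boldsymbol\Omega_k^{-1/2}$ with $\mathbf D_k\in\mathbb R^{n_k\times n_k}$ square and diagonal (so $\mathbf U_k\in\mathbb C^{n_k\times n_k}$ is unitary and $\mathbf V_k\in\mathbb C^{\bar n_k\times n_k}$ has orthonormal columns). Then the matrices $$\mathbf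 S_k=\boldsymbol\Omega_k^{-1/2}\,\mathbf V_k\mathbf U_k^H\,\mathbf Q_k\,\mathbf U_k\mathbf V_k^H\,\boldsymbol\Omega_k^{-1/2},\qquad k=1,\dots,K,$$ form an optimal solution of (A).
   Context: Notation: $|\cdot|$ is the determinant, $\operatorname{tr}$ the trace, $(\cdot)^H$ the conjugate transpose, $[\cdot]_{n,n}$ the $n$th diagonal entry, $\mathbf X\succeq\mathbf 0$ means Hermitian positive semidefinite, $\operatorname{diag}(\mathbf x)$ is the diagonal matrix with diagonal $\mathbf x$, $\log$ is the natural logarithm, and $\boldsymbol\psi\ge0$ is entrywise. $\boldsymbol\Omega^{-1/2}$ is the inverse of the positive definite square root of a positive definite matrix $\boldsymbol\Omega$. Definitions. $\bar{\mathbf H}_k=[\mathbf H_1^T\cdots\mathbf H_{k-1}^T\ \mathbf H_{k+1}^T\cdots\mathbf H_K^T]^T$ is the matrix obtained by stacking all $\mathbf H_i$ with $i\ne k$; $\bar n_k=N-\sum_{i\ne k}n_i$ is the dimension of its null space; $\bar{\mathbf V}_k\in\mathbb C^{N\times\bar n_k}$ is a fixed matrix whose columns form a basis of the null space of $\bar{\mathbf H}_k$ (if $K=1$, a basis of $\mathbb C^N$). $\tilde{\mathbf H}_k=\mathbf H_k\bar{\mathbf V}_k\in\mathbb C^{n_k\times\bar n_k}$ and $\tilde{\mathbf G}_{mk}=\mathbf G_m\bar{\mathbf V}_k\in\mathbb C^{\tilde n_m\times\bar n_k}$. For $\boldsymbol\psi=[\boldsymbol\eta^T\ \boldsymbol\lambda^T]^T$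 with $\boldsymbol\eta\in\mathbb R^N$, $\boldsymbol\lambda\in\mathbb R^M$, set $\boldsymbol\Lambda=\operatorname{diag}(\boldsymbol\eta)+\sum_{m=1}^M\lambda_m\mathbf G_m^H\mathbf G_m$ and $\boldsymbol\Omega_k=\bar{\mathbf V}_k^H\boldsymbol\Lambda\bar{\mathbf V}_k$. Also $\mathbf p=[P_1,\dots,P_N,I_1,\dots,I_M]^T$. An optimal solution (saddle point) of (B) is a feasible pair $(\boldsymbol\psi^*,\{\mathbf Q_k^*\})$ with $\tilde f(\boldsymbol\psi^*,\{\mathbf Q_k\})\le\tilde f(\boldsymbol\psi^*,\{\mathbf Q_k^*\})\le\tilde f(\boldsymbol\psi,\{\mathbf Q_k^*\})$ for all feasible $\boldsymbol\psi$ and all feasible $\{\mathbf Q_k\}$. *)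

(* Defs.v *)
From mathcomp Require Import all_boot all_order all_algebra.
From mathcomp Require Import spectral sesquilinear complex.
From mathcomp Require Import interval_inference boolp classical_sets reals.
From mathcomp Require Import exp convex.

Set Implicit Arguments.
Unset Strict Implicit.
Unset Printing Implicit Defensive.

Import Order.TTheory GRing.Theory Num.Theory.

Local Open Scope classical_set_scope.
Local Open Scope sesquilinear_scope.
Local Open Scope complex_scope.
Local Open Scope ring_scope.

(* On [R[i]], [0 <= z] says that z is real and nonnegative. *)
Definition psdmx {R : realType} n (A : 'M[R[i]]_n) : Prop :=
  A \is hermsymmx /\ forall x : 'cV[R[i]]_n, 0 <= (x^t* *m A *m x) 0 0.

Definition posdefmx {R : realType} n (A : 'M[R[i]]_n) : Prop :=
  A \is hermsymmx /\
  forall x : 'cV[R[i]]_n, x != 0 -> 0 < (x^t* *m A *m x) 0 0.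

(* The positive definite square root of A; the value is 0 when A has none,
   i.e. when A is not positive definite. *)
Definition sqrtmx {R : realType} n (A : 'M[R[i]]_n) : 'M[R[i]]_n :=
  xget 0 [set B | posdefmx B /\ B *m B = A].

Lemma trmxC_mul (R : realType) m n p (A : 'M[R[i]]_(m, n)) (B : 'M_(n, p)) :
  (A *m B)^t* = B^t* *m A^t*.
Proof. by rewrite trmx_mul map_mxM. Qed.

Lemma diag_qform (R : realType) n (D : 'rV[R[i]]_n) (x : 'cV_n) :
  (x^t* *m diag_mx D *m x) 0 0 = \sum_i D 0 i * `|x i 0| ^+ 2.
Proof.
rewrite -mulmxA mxE; apply: eq_bigr => i _.
rewrite mul_diag_mx !mxE mulrCA; congr (_ * _).
by rewrite normCK mulrC.
Qed.

Lemma sqrtmxP (R : realType) n (A : 'M[R[i]]_n) :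
  posdefmx A -> posdefmx (sqrtmx A) /\ sqrtmx A *m sqrtmx A = A.
Proof.
move=> [hA pA]; rewrite /sqrtmx.
apply: (@xgetPex _ 0 [set B | posdefmx B /\ B *m B = A]).
have /orthomx_spectralP := hermitian_normalmx hA.
set P := spectralmx A; set D := spectral_diag A => EA.
have uP : P \is unitarymx by exact: spectral_unitarymx.
have iP : invmx P = P^t* by rewrite invmx_unitary.
have PP : P *m P^t* = 1%:M by apply/unitarymxP.
have PP' : P^t* *m P = 1%:M by rewrite -iP mulVmx // unitarymx_unit.
have qf (E : 'rV[R[i]]_n) (x : 'cV[R[i]]_n) :
    (x^t* *m (P^t* *m diag_mx E *m P) *m x) 0 0 =
    \sum_i E 0 i * `|(P *m x) i 0| ^+ 2.
  by rewrite -diag_qform trmxC_mul !mulmxA.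
have D0 i : 0 < D 0 i.
  have := pA (P^t* *m delta_mx i 0); rewrite EA iP qf mulmxA PP mul1mx.
  rewrite (bigD1 i) //= big1 ?addr0; last first.
    by move=> j ji; rewrite mxE eqxx andbT (negbTE ji) normr0 expr0n mulr0.
  rewrite mxE !eqxx normr1 expr1n mulr1; apply.
  apply/eqP => /(congr1 (mulmx P)); rewrite mulmxA PP mul1mx mulmx0.
  by move/matrixP/(_ i 0); rewrite !mxE !eqxx => /eqP; rewrite oner_eq0.
exists (P^t* *m diag_mx (map_mx sqrtC D) *m P); split; last first.
  rewrite [RHS]EA iP !mulmxA; congr (_ *m _); rewrite -!mulmxA; congr (_ *m _).
  rewrite !mulmxA -(mulmxA _ P) PP mulmx1 mulmx_diag; congr diag_mx.
  by apply/rowP => i; rewrite !mxE -expr2 sqrtCK.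
split.
  apply/is_hermitianmxP; rewrite expr0 scale1r !trmxC_mul trmxCK mulmxA.
  congr (_ *m _ *m _).
  rewrite tr_diag_mx map_diag_mx; congr diag_mx; apply/rowP => i; rewrite !mxE.
  by apply/esym/CrealP/ger0_real; rewrite sqrtC_ge0 ltW.
move=> x x0; rewrite qf lt_def sumr_ge0 ?andbT; last first.
  by move=> i _; rewrite mulr_ge0 ?exprn_ge0 // mxE sqrtC_ge0 ltW.
apply: contra_neq x0 => /eqP; rewrite psumr_eq0 => [|i _]; last first.
  by rewrite mulr_ge0 ?exprn_ge0 // mxE sqrtC_ge0 ltW.
move/allP => h; rewrite -[x]mul1mx -PP' -mulmxA (_ : P *m x = 0) ?mulmx0 //.
apply/colP => i; have := h i (mem_index_enum _).
rewrite implyTb mulf_eq0 mxE sqrtC_eq0 gt_eqF //= sqrf_eq0 normr_eq0 => /eqP ->.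
by rewrite mxE.
Qed.

(* The columns of B form a basis of the null space of A. *)
Definition null_basis {F : fieldType} m n r
    (A : 'M[F]_(m, n)) (B : 'M[F]_(n, r)) : Prop :=
  row_free B^T /\
  forall x : 'cV[F]_n, A *m x = 0 <-> exists c : 'cV[F]_r, x = B *m c.

(* Thin singular value decomposition A = U diag(d) V^H with a square middle
   factor: V has as many columns as A has rows. *)
Definition is_svd {R : realType} m n (A : 'M[R[i]]_(m, n))
    (U : 'M[R[i]]_m) (d : 'rV[R]_m) (V : 'M[R[i]]_(n, m)) : Prop :=
  [/\ U \is unitarymx, V^t* *m V = 1%:M, forall i, 0 <= d 0 i
    & A = U *m diag_mx (map_mx (fun a : R => a%:C) d) *m V^t*].

Section Network.
Context {R : realType} {K M N : nat} {n : 'I_K -> nat} {nt : 'I_M -> nat}.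
Local Notation C := R[i].

(* No truncation occurs once the stacked matrix has full row rank. *)
Definition nbar (k : 'I_K) : nat := (N - \sum_(i | i != k) n i)%N.

Context (H : forall k, 'M[C]_(n k, N)) (G : forall m, 'M[C]_(nt m, N)).

Definition Hstack : 'M[C]_(\sum_k n k, N) := \mxcol_k H k.

(* [lift k] enumerates the indices different from k in increasing order. *)
Definition Hbar (k : 'I_K) : 'M[C]_(\sum_(j < K.-1) n (lift k j), N) :=
  \mxcol_(j < K.-1) H (lift k j).

Context (Vb : forall k, 'M[C]_(N, nbar k)).

Definition Htilde (k : 'I_K) : 'M[C]_(n k, nbar k) := H k *m Vb k.

Definition Gtilde (m : 'I_M) (k : 'I_K) : 'M[C]_(nt m, nbar k) := G m *m Vb k.

(* psi stacks eta : 'cV_N on top of lambda : 'cV_M. *)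
Definition Lambda (psi : 'cV[R]_(N + M)) : 'M[C]_N :=
  diag_mx (\row_j (usubmx psi j 0)%:C) +
  \sum_m (dsubmx psi m 0)%:C *: ((G m)^t* *m G m).

Definition Omega (psi : 'cV[R]_(N + M)) (k : 'I_K) : 'M[C]_(nbar k) := (Vb k)^t* *m Lambda psi *m Vb k.

(* The determinants and traces below are real on the domains where they are
   used, so that taking their real part only changes their type. *)

Definition primal_obj (S : forall k, 'M[C]_(nbar k)) : R :=
  \sum_k ln (complex.Re (\det (1%:M + Htilde k *m S k *m (Htilde k)^t*))).

Definition primal_feasible (P : 'cV[R]_N) (I : 'cV[R]_M)
    (S : forall k, 'M[C]_(nbar k)) : Prop :=
  [/\ forall k, psdmx (S k),
      forall j, \sum_k complex.Re ((Vb k *m S k *m (Vb k)^t*) j j) <= P j 0,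
      forall m, \sum_k complex.Re (\tr (Gtilde m k *m S k *m (Gtilde m k)^t*))
                <= I m 0
    & forall k, (\rank (S k) <= n k)%N].

Definition primal_optimal (P : 'cV[R]_N) (I : 'cV[R]_M)
    (S : forall k, 'M[C]_(nbar k)) : Prop :=
  primal_feasible P I S /\
  forall S', primal_feasible P I S' -> primal_obj S' <= primal_obj S.

Definition ftilde (psi : 'cV[R]_(N + M)) (Q : forall k, 'M[C]_(n k)) : R :=
  \sum_k ln (complex.Re
    (\det (Omega psi k + (Htilde k)^t* *m Q k *m Htilde k)
     / \det (Omega psi k))).

Definition psi_domain : set 'cV[R]_(N + M) :=
  [set psi : 'cV[R]_(N + M) |
    (forall i, 0 <= psi i 0) /\ forall k, Omega psi k \in unitmx].

Definition Q_domain : set (forall k, 'M[C]_(n k)) :=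
  [set Q | forall k, psdmx (Q k)].

Definition psi_feasible (P : 'cV[R]_N) (I : 'cV[R]_M) (Ptot : R)
    (psi : 'cV[R]_(N + M)) : Prop :=
  psi_domain psi /\ ((col_mx P I)^T *m psi) 0 0 <= Ptot.

Definition Q_feasible (Ptot : R) (Q : forall k, 'M[C]_(n k)) : Prop :=
  Q_domain Q /\ \sum_k complex.Re (\tr (Q k)) <= Ptot.

Definition saddle_point (P : 'cV[R]_N) (I : 'cV[R]_M) (Ptot : R)
    (psi : 'cV[R]_(N + M)) (Q : forall k, 'M[C]_(n k)) : Prop :=
  [/\ psi_feasible P I Ptot psi, Q_feasible Ptot Q,
      forall Q', Q_feasible Ptot Q' -> ftilde psi Q' <= ftilde psi Q
    & forall psi', psi_feasible P I Ptot psi' -> ftilde psi Q <= ftilde psi' Q].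

End Network.

(* Concavity on a convex set of families of complex matrices, regarded as a
   real vector space. *)
Definition concave_family {R : realType} {K : nat} {n : 'I_K -> nat}
    (D : set (forall k, 'M[R[i]]_(n k)))
    (f : (forall k, 'M[R[i]]_(n k)) -> R) : Prop :=
  forall (t : R) Q Q', 0 <= t <= 1 -> D Q -> D Q' ->
    let Qt := fun k => t%:C *: Q k + (1 - t)%:C *: Q' k in
    D Qt /\ t * f Q + (1 - t) * f Q' <= f Qt.

(* Main.v *)
Require Import Defs.
From mathcomp Require Import all_boot all_order all_algebra.
From mathcomp Require Import spectral sesquilinear complex.
From mathcomp Require Import interval_inference boolp classical_sets reals exp convex.
From mathcomp Require Import ring lra.
Import Order.TTheory GRing.Theory Num.Theory.
Local Open Scope sesquilinear_scope.
Local Open Scope ring_scope.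

Set Implicit Arguments.
Unset Strict Implicit.
Unset Printing Implicit Defensive.

(* Let [mu] be the multiplier of the total power constraint on [Q] at the saddle
   point and [X_k = Ht_k (Omega_k + Ht_k^H Q_k Ht_k)^-1 Ht_k^H] the gradient in
   [Q_k]; optimality of [Q] gives [X_k <= mu 1] and [X_k Q_k = mu Q_k].  In the
   coordinates of the singular value decomposition the latter forces [U^H Q U]
   to commute with [D], whence
   [Omega_k^-1 - (Omega_k + Ht_k^H Q_k Ht_k)^-1 = mu S_k]: up to the factor
   [- mu], the gradient of the objective in [psi] is the resource consumption of
   [S].  Stationarity in [psi] is therefore primal feasibility of [S].
   Conversely [X_k <= mu 1] reads
   [Ht_k^H (1 + Ht_k S_k Ht_k^H)^-1 Ht_k <= mu Omega_k], so the tangent bound of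
   log det at [S] makes [psi] a dual certificate of the optimality of [S].
   All derivatives are replaced by the tangent bound of log det together with a
   quadratic lower bound along lines. *)

(** * Hermitian positive semidefinite matrices *)

Section HermitianMatrices.
Local Open Scope complex_scope.
Context {R : realType}.
Local Notation C := R[i].

Lemma ReM_real (t : R) (z : C) : complex.Re (t%:C * z) = t * complex.Re z.
Proof. by case: z => a b /=; rewrite mul0r subr0. Qed.

Lemma Re_ge0 {z : C} : 0 <= z -> 0 <= complex.Re z.
Proof. by rewrite lecE => /andP[]. Qed.

Lemma Re_gt0 {z : C} : 0 < z -> 0 < complex.Re z.
Proof. by rewrite ltcE => /andP[]. Qed.

Lemma ReK {z : C} : 0 <= z -> (complex.Re z)%:C = z.
Proof. by case: z => a b; rewrite lecE /= => /andP[/eqP -> _]. Qed.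

Lemma conjC_real (t : R) : Num.conj (t%:C : C) = t%:C.
Proof. by apply/CrealP; rewrite complex_real. Qed.

Lemma trmxCD m n (A B : 'M[C]_(m, n)) : (A + B)^t* = A^t* + B^t*.
Proof. by rewrite linearD /= map_mxD. Qed.

Lemma trmxCB m n (A B : 'M[C]_(m, n)) : (A - B)^t* = A^t* - B^t*.
Proof. by rewrite linearB /= map_mxB. Qed.

Lemma trmxCZ m n (t : R) (A : 'M[C]_(m, n)) : (t%:C *: A)^t* = t%:C *: A^t*.
Proof. by rewrite linearZ /= map_mxZ; congr (_ *: _); apply: conjC_real. Qed.

Lemma trmxC1 n : (1%:M : 'M[C]_n)^t* = 1%:M.
Proof. by rewrite trmx1 map_mx1. Qed.

Lemma trmxCV n (A : 'M[C]_n) : (invmx A)^t* = invmx (A^t*).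
Proof. by rewrite trmx_inv map_invmx. Qed.

Lemma det_trmxC n (A : 'M[C]_n) : \det (A^t*) = Num.conj (\det A).
Proof. by rewrite det_map_mx det_tr. Qed.

Lemma trmxC_real_diag n (d : 'rV[R]_n) :
  (diag_mx (map_mx (real_complex R) d))^t* = diag_mx (map_mx (real_complex R) d).
Proof.
rewrite tr_diag_mx map_diag_mx; congr diag_mx.
by apply/rowP => i; rewrite !mxE; apply: conjC_real.
Qed.

Lemma hermP n (A : 'M[C]_n) : A \is hermsymmx <-> A^t* = A.
Proof.
split; first by move/is_hermitianmxP; rewrite expr0 scale1r => {2}->.
by move=> h; apply/is_hermitianmxP; rewrite expr0 scale1r h.
Qed.

Lemma herm_spectral n (A : 'M[C]_n) : A \is hermsymmx ->
  exists (P : 'M[C]_n) (l : 'rV[R]_n),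
    [/\ P *m P^t* = 1%:M, P^t* *m P = 1%:M
      & A = P^t* *m diag_mx (map_mx (real_complex R) l) *m P].
Proof.
move=> hA; have /orthomx_spectralP EA := hermitian_normalmx hA.
have uP := spectral_unitarymx A.
exists (spectralmx A), (map_mx (@complex.Re R) (spectral_diag A)); split.
- exact/unitarymxP.
- by rewrite -invmx_unitary // mulVmx // unitarymx_unit.
- suff -> : map_mx (real_complex R) (map_mx (@complex.Re R) (spectral_diag A)) =
    spectral_diag A by rewrite -invmx_unitary.
  apply/rowP => j; rewrite !mxE.
  have /mxOverP/(_ 0 j) := hermitian_spectral_diag_real hA.
  by move/Creal_ImP => h; rewrite [RHS]complexE complexIm h mulr0 addr0.
Qed.

Lemma gram_psd m n (L : 'M[C]_(m, n)) : psdmx (L^t* *m L).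
Proof.
split=> [|x]; first by apply/hermP; rewrite trmxC_mul trmxCK.
rewrite mulmxA -trmxC_mul -mulmxA mxE sumr_ge0 // => j _.
by rewrite !mxE mulrC -normCK exprn_ge0.
Qed.

(** The trace is the sum of the squared moduli of the entries of [L]. *)
Lemma gram_eq0 m n (L : 'M[C]_(m, n)) : \tr (L^t* *m L) = 0 -> L = 0.
Proof.
move=> h; apply/matrixP => i j; rewrite mxE.
have e k : (L^t* *m L) k k = \sum_i `|L i k| ^+ 2.
  by rewrite mxE; apply: eq_bigr => l _; rewrite !mxE mulrC normCK.
move: h; rewrite /mxtrace (eq_bigr _ (fun k _ => e k)) => /eqP.
rewrite psumr_eq0 => [/allP/(_ j)|k _]; last by rewrite sumr_ge0 // => l _; rewrite exprn_ge0.
rewrite mem_index_enum implyTb => /(_ isT).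
rewrite psumr_eq0 => [/allP/(_ i)|l _]; last by rewrite exprn_ge0.
by rewrite mem_index_enum implyTb => /(_ isT); rewrite sqrf_eq0 normr_eq0 => /eqP.
Qed.

Lemma psd_congr n p (A : 'M[C]_n) (B : 'M[C]_(n, p)) :
  psdmx A -> psdmx (B^t* *m A *m B).
Proof.
move=> [hA pA]; split=> [|x].
  by apply/hermP; rewrite !trmxC_mul trmxCK mulmxA; move/hermP: hA => ->.
by have := pA (B *m x); rewrite trmxC_mul !mulmxA.
Qed.

Lemma psd_congrC n p (A : 'M[C]_n) (B : 'M[C]_(p, n)) :
  psdmx A -> psdmx (B *m A *m B^t*).
Proof. by move=> hA; rewrite -[X in X *m A]trmxCK; apply: psd_congr. Qed.

Lemma psdD n (A B : 'M[C]_n) : psdmx A -> psdmx B -> psdmx (A + B).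
Proof.
move=> [hA pA] [hB pB]; split=> [|x].
  by apply/hermP; rewrite trmxCD; move/hermP: hA => ->; move/hermP: hB => ->.
by rewrite mulmxDr mulmxDl mxE addr_ge0.
Qed.

Lemma psdZ n (t : R) (A : 'M[C]_n) : 0 <= t -> psdmx A -> psdmx (t%:C *: A).
Proof.
move=> t0 [hA pA]; split=> [|x].
  by apply/hermP; rewrite trmxCZ; move/hermP: hA => ->.
by rewrite -scalemxAr -scalemxAl mxE mulr_ge0 // ler0c.
Qed.

Lemma psd0 n : psdmx (0 : 'M[C]_n).
Proof.
split=> [|x]; first by apply/hermP; rewrite trmx0 map_mx0.
by rewrite mulmx0 mul0mx mxE.
Qed.

Lemma psd_sum n (J : Type) (r : seq J) (p : pred J) (A : J -> 'M[C]_n) :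
  (forall j, p j -> psdmx (A j)) -> psdmx (\sum_(j <- r | p j) A j).
Proof. by move=> h; apply: (big_ind (@psdmx R n)); [exact: psd0 | exact: psdD | exact: h]. Qed.

Lemma pd_psd n (A : 'M[C]_n) : posdefmx A -> psdmx A.
Proof.
move=> [hA pA]; split=> // x; have [->|/pA/ltW //] := eqVneq x 0.
by rewrite mulmx0 mxE.
Qed.

Lemma pd_congr n p (A : 'M[C]_n) (B : 'M[C]_(n, p)) :
  posdefmx A -> (forall x : 'cV_p, B *m x = 0 -> x = 0) ->
  posdefmx (B^t* *m A *m B).
Proof.
move=> pdA injB; have [hBA _] := psd_congr B (pd_psd pdA).
split=> // x x0; have := pdA.2 (B *m x); rewrite trmxC_mul !mulmxA; apply.
by apply: contra_neq x0; apply: injB.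
Qed.

Lemma pd_congr_unit n (A B : 'M[C]_n) :
  posdefmx A -> B \in unitmx -> posdefmx (B^t* *m A *m B).
Proof.
move=> pdA uB; apply: pd_congr => // x /(congr1 (mulmx (invmx B))).
by rewrite mulKmx // mulmx0.
Qed.

Lemma pdDpsd n (A B : 'M[C]_n) : posdefmx A -> psdmx B -> posdefmx (A + B).
Proof.
move=> pdA psB; have [h _] := psdD (pd_psd pdA) psB; split=> // x x0.
by rewrite mulmxDr mulmxDl mxE ltr_wpDr // ?psB.2 // pdA.2.
Qed.

Lemma pdZ n (t : R) (A : 'M[C]_n) : 0 < t -> posdefmx A -> posdefmx (t%:C *: A).
Proof.
move=> t0 pdA; have [h _] := psdZ (ltW t0) (pd_psd pdA).
split=> // x x0; rewrite -scalemxAr -scalemxAl mxE mulr_gt0 ?pdA.2 //.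
by rewrite ltcR.
Qed.

Lemma pd1 n : posdefmx (1%:M : 'M[C]_n).
Proof.
have := @gram_psd n n 1%:M; rewrite trmxC1 mulmx1 => p1; split=> [|x x0]; first exact: p1.1.
rewrite lt_def p1.2 andbT; apply: contra_neq x0; rewrite mulmx1 => h.
by apply: gram_eq0; rewrite /mxtrace big_ord1.
Qed.

Lemma inj_unitmx n (A : 'M[C]_n) :
  (forall x : 'cV_n, A *m x = 0 -> x = 0) -> A \in unitmx.
Proof.
move=> inj; rewrite -unitmx_tr -row_free_unit -kermx_eq0.
apply/eqP/row_matrixP => i; rewrite row0; apply: trmx_inj; rewrite trmx0.
by apply: inj; rewrite -[X in X *m _]trmxK -trmx_mul -row_mul mulmx_ker row0 trmx0.
Qed.

Lemma pd_unit n (A : 'M[C]_n) : posdefmx A -> A \in unitmx.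
Proof.
move=> [_ pA]; apply: inj_unitmx => x Ax; apply/eqP; apply: contraT => /pA.
by rewrite -mulmxA Ax mulmx0 mxE ltxx.
Qed.

Lemma psd_factor n (A : 'M[C]_n) : psdmx A -> exists L : 'M[C]_n, A = L^t* *m L.
Proof.
move=> [/herm_spectral [P [l [PP _ EA]]] pA].
have l0 i : 0 <= l 0 i.
  (* At the [i]-th column of [P^t*], an eigenvector, the quadratic form is the eigenvalue
     [l 0 i]. *)
  have := pA (P^t* *m delta_mx i 0).
  rewrite EA trmxC_mul trmxCK !mulmxA -(mulmxA _ P) PP mulmx1 -(mulmxA _ P) PP mulmx1.
  rewrite diag_qform (bigD1 i) //= big1 ?addr0; last first.
    by move=> j ji; rewrite [X in `|X|]mxE eqxx andbT (negbTE ji) normr0 expr0n mulr0.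
  by rewrite !mxE !eqxx normr1 expr1n mulr1 ler0c.
exists (diag_mx (map_mx (real_complex R) (map_mx Num.sqrt l)) *m P).
rewrite EA trmxC_mul trmxC_real_diag -!mulmxA (mulmxA (diag_mx _)) mulmx_diag.
set D := (X in _ = _ *m (diag_mx X *m _)); suff -> : D = map_mx (real_complex R) l by [].
by apply/rowP => i; rewrite !mxE -rmorphM -expr2 sqr_sqrtr.
Qed.

Lemma psd_unit_pd n (A : 'M[C]_n) : psdmx A -> A \in unitmx -> posdefmx A.
Proof.
move=> psA uA; have [L EL] := psd_factor psA.
have uL : L \in unitmx by move: uA; rewrite EL unitmx_mul => /andP[].
by rewrite EL -[_^t*]mulmx1; apply: pd_congr_unit => //; apply: pd1.
Qed.

Lemma pd_factor n (A : 'M[C]_n) : posdefmx A ->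
  exists2 L : 'M[C]_n, L \in unitmx & A = L^t* *m L.
Proof.
move=> pdA; have [L EL] := psd_factor (pd_psd pdA); exists L => //.
by have := pd_unit pdA; rewrite EL unitmx_mul => /andP[].
Qed.

Lemma pd_inv n (A : 'M[C]_n) : posdefmx A -> posdefmx (invmx A).
Proof.
move=> pdA; have uA := pd_unit pdA.
have -> : invmx A = (invmx A)^t* *m A *m invmx A.
  by rewrite -mulmxA mulmxV // mulmx1 trmxCV; have /hermP -> := pdA.1.
by apply: pd_congr_unit; rewrite ?unitmx_inv.
Qed.

Lemma pd_convex n (t : R) (A B : 'M[C]_n) : 0 <= t <= 1 ->
  posdefmx A -> posdefmx B -> posdefmx (t%:C *: A + (1 - t)%:C *: B).
Proof.
move=> /andP[t0 t1] pdA pdB; have [->|tN0] := eqVneq t 0.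
  by rewrite scale0r add0r subr0 scale1r.
apply: pdDpsd; first by apply: pdZ => //; rewrite lt_def tN0.
by apply: psdZ; rewrite ?subr_ge0 //; apply: pd_psd.
Qed.

Lemma pd_det_gt0 n (A : 'M[C]_n) : posdefmx A -> 0 < \det A.
Proof.
move=> /pd_factor [L uL ->]; rewrite det_mulmx det_trmxC mulrC -normCK.
by rewrite exprn_gt0 // normr_gt0 -unitfE -unitmxE.
Qed.

(** [retr (A *m B)] is the real pairing in which all first-order terms of log det are written. *)
Definition retr n (A : 'M[C]_n) : R := complex.Re (\tr A).

Lemma retrD n (A B : 'M[C]_n) : retr (A + B) = retr A + retr B.
Proof. by rewrite /retr mxtraceD raddfD. Qed.

Lemma retrB n (A B : 'M[C]_n) : retr (A - B) = retr A - retr B.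
Proof. by rewrite /retr raddfB raddfB. Qed.

Lemma retrZ n t (A : 'M[C]_n) : retr (t%:C *: A) = t * retr A.
Proof. by rewrite /retr mxtraceZ ReM_real. Qed.

Lemma retr_sum n (J : finType) (A : J -> 'M[C]_n) :
  retr (\sum_j A j) = \sum_j retr (A j).
Proof. by rewrite /retr (raddf_sum (@mxtrace C n)) raddf_sum. Qed.

Lemma retrC m n (A : 'M[C]_(m, n)) (B : 'M[C]_(n, m)) :
  retr (A *m B) = retr (B *m A).
Proof. by rewrite /retr mxtrace_mulC. Qed.

Lemma retr0 n : retr (0 : 'M[C]_n) = 0.
Proof. by rewrite /retr mxtrace0. Qed.

Lemma retr_sandwich m p (A : 'M[C]_p) (B : 'M_(m, p)) (D : 'M_m) :
  retr (A *m (B^t* *m D *m B)) = retr (B *m A *m B^t* *m D).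
Proof. by rewrite mulmxA retrC !mulmxA. Qed.

Lemma retr_gram m p (A : 'M[C]_p) (B : 'M_(m, p)) :
  retr (A *m (B^t* *m B)) = retr (B *m A *m B^t*).
Proof. by rewrite mulmxA retrC mulmxA. Qed.

(** With [A] and [B] the inverses of [Om + F] and [Om], this turns a directional derivative in [psi]
    into a difference of costs of [S]. *)
Lemma retr_mulB p (a : R) (A B S X Y : 'M[C]_p) :
  B - A = a%:C *: S ->
  retr ((A - B) *m (X - Y)) = a * (retr (S *m Y) - retr (S *m X)).
Proof.
move=> e; rewrite -retrB -retrZ -mulmxBr scalemxAl -e.
by rewrite -(opprB B A) -(opprB Y X) mulNmx mulmxN opprK.
Qed.

Lemma retr_qform p (A : 'M[C]_p) (x : 'cV_p) :
  retr (A *m ((x^t*)^t* *m x^t*)) = complex.Re ((x^t* *m A *m x) 0 0).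
Proof. by rewrite retr_gram trmxCK /retr /mxtrace big_ord1. Qed.

Lemma psd_diag_ge0 n (A : 'M[C]_n) i : psdmx A -> 0 <= A i i.
Proof.
move=> [_ /(_ (delta_mx i 0))].
rewrite -mulmxA -colE trmx_delta map_delta_mx -rowE.
by rewrite !mxE.
Qed.

Lemma psd_tr_ge0 n (A : 'M[C]_n) : psdmx A -> 0 <= \tr A.
Proof. by move=> psA; rewrite sumr_ge0 // => i _; apply: psd_diag_ge0. Qed.

Lemma psd_retr_ge0 n (A : 'M[C]_n) : psdmx A -> 0 <= retr A.
Proof. by move=> /psd_tr_ge0; apply: Re_ge0. Qed.

Lemma psd_mul_retr_ge0 n (A B : 'M[C]_n) :
  psdmx A -> psdmx B -> 0 <= retr (A *m B).
Proof.
move=> psA /psd_factor [L ->]; rewrite mulmxA retrC mulmxA.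
by apply: psd_retr_ge0; apply: psd_congrC.
Qed.

(** For [A = K^H K] and [B = L^H L] the trace is the squared Frobenius norm of [K L^H], a factor of
    the product [A B]. *)
Lemma psd_mul_retr_eq0 n (A B : 'M[C]_n) :
  psdmx A -> psdmx B -> retr (A *m B) = 0 -> A *m B = 0.
Proof.
move=> /psd_factor [K ->] /psd_factor [L ->] h.
have e : \tr (K^t* *m K *m (L^t* *m L)) = \tr ((K *m L^t*)^t* *m (K *m L^t*)).
  by rewrite trmxC_mul trmxCK !mulmxA mxtrace_mulC !mulmxA.
have KL : K *m L^t* = 0.
  apply: gram_eq0; rewrite -e -[LHS]ReK; first by move: h; rewrite /retr => ->.
  by rewrite e; apply: psd_tr_ge0; apply: gram_psd.
by rewrite mulmxA -(mulmxA _ K) KL mulmx0 mul0mx.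
Qed.

End HermitianMatrices.

(** * The log-determinant *)

Section LogDet.
Local Open Scope complex_scope.
Context {R : realType}.
Local Notation C := R[i].

(** Sylvester's identity: multiplying [Z] by the unimodular [Y] on the right or on the left gives a
    block triangular matrix carrying one of the two determinants. *)
Lemma det_1subC (F : comNzRingType) m n (A : 'M[F]_(m, n)) (B : 'M[F]_(n, m)) :
  \det (1%:M - A *m B) = \det (1%:M - B *m A).
Proof.
pose Z := block_mx 1%:M A B 1%:M; pose Y := block_mx 1%:M 0 (- B) 1%:M.
have dY : \det Y = 1 by rewrite det_lblock !det1 mulr1.
transitivity (\det Z).
  rewrite -[RHS]mulr1 -[X in _ * X]dY -det_mulmx mulmx_block !mulmx1 !mul1mx mulmx0 !add0r.
  by rewrite mulmxN subrr det_ublock det1 mulr1.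
rewrite -[LHS]mul1r -[X in X * _]dY -det_mulmx mulmx_block !mul1mx !mulmx1 !mul0mx !addr0.
by rewrite addNr mulNmx addrC det_ublock det1 mul1r.
Qed.

Lemma ln_prod (J : finType) (f : J -> R) : (forall j, 0 < f j) ->
  ln (\prod_j f j) = \sum_j ln (f j).
Proof.
move=> f0; suff [] : 0 < \prod_j f j /\ ln (\prod_j f j) = \sum_j ln (f j) by [].
elim/big_rec2: _ => [|j x y _ [y0 yE]]; first by rewrite ltr01 ln1.
by rewrite mulr_gt0 // lnM ?posrE // yE.
Qed.

(** The bound [ln (1 + y) <= y] at [y = (1 + x)^-1 - 1] gives [x / (1 + x) <= ln (1 + x)]; the rest
    amounts to [0 <= x^2 (1 + 2 x)], whence the range of [x]. *)
Lemma ln1D_ge (x : R) : - 2^-1 <= x -> x - 2 * x ^+ 2 <= ln (1 + x).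
Proof.
move=> hx; have x1 : 0 < 1 + x by lra.
have := le_ln1Dx (_ : -1 < (1 + x)^-1 - 1).
rewrite ltrBrDl subrr invr_gt0 => /(_ x1).
rewrite addrC subrK lnV ?posrE // => h.
suff : x - 2 * x ^+ 2 <= 1 - (1 + x)^-1 by lra.
have -> : 1 - (1 + x)^-1 = x / (1 + x) by field; lra.
rewrite ler_pdivlMr //; nra.
Qed.

Definition logdet n (A : 'M[C]_n) : R := ln (complex.Re (\det A)).

Lemma logdetM n (A B : 'M[C]_n) : 0 < \det A -> 0 < \det B ->
  logdet (A *m B) = logdet A + logdet B.
Proof.
move=> A0 B0; rewrite /logdet det_mulmx -(ReK (ltW A0)) ReM_real.
by rewrite lnM // posrE Re_gt0.
Qed.

Lemma logdet_congr n (L A : 'M[C]_n) : L \in unitmx -> 0 < \det A ->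
  logdet (L^t* *m A *m L) = logdet (L^t* *m L) + logdet A.
Proof.
move=> uL A0; have L0 : 0 < \det (L^t* *m L).
  rewrite det_mulmx det_trmxC mulrC -normCK exprn_gt0 // normr_gt0.
  by rewrite -unitfE -unitmxE.
by rewrite -(logdetM L0 A0) /logdet !det_mulmx mulrAC.
Qed.

Section Spectral1D.
Variables (n : nat) (P : 'M[C]_n) (l : 'rV[R]_n).
Hypotheses (PP : P *m P^t* = 1%:M) (PP' : P^t* *m P = 1%:M).
Let E := P^t* *m diag_mx (map_mx (real_complex R) l) *m P.

Lemma det_1D_spectral : \det (1%:M + E) = (\prod_i (1 + l 0 i))%:C.
Proof.
have -> : 1%:M + E = P^t* *m diag_mx (map_mx (real_complex R) (\row_i (1 + l 0 i))) *m P.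
  have -> : diag_mx (map_mx (real_complex R) (\row_i (1 + l 0 i))) =
            1%:M + diag_mx (map_mx (real_complex R) l).
    rewrite -diag_const_mx -linearD /=; congr diag_mx.
    by apply/rowP => i; rewrite !mxE rmorphD.
  by rewrite mulmxDr mulmxDl mulmx1 PP'.
rewrite !det_mulmx mulrC mulrA -det_mulmx PP det1 mul1r det_diag rmorph_prod /=.
by apply: eq_bigr => i _; rewrite !mxE.
Qed.

Lemma retr_spectral : retr E = \sum_i l 0 i.
Proof.
rewrite /E retrC mulmxA PP mul1mx /retr mxtrace_diag raddf_sum /=.
by apply: eq_bigr => i _; rewrite mxE.
Qed.

Lemma pd_1D_spectral : posdefmx (1%:M + E) -> forall i, 0 < 1 + l 0 i.
Proof.
move=> [_ p1] i; have := p1 (P^t* *m delta_mx i 0).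
rewrite mulmxDr mulmxDl mxE mulmx1 !trmxC_mul trmxCK.
rewrite mulmxA -(mulmxA _ P) PP mulmx1 /E !mulmxA -(mulmxA _ P) PP mulmx1.
rewrite -(mulmxA _ P) PP mulmx1 diag_qform (bigD1 i) //= big1 ?addr0; last first.
  by move=> j ji; rewrite [X in `|X|]mxE eqxx andbT (negbTE ji) normr0 expr0n mulr0.
rewrite trmx_delta map_delta_mx mul_delta_mx !mxE !eqxx normr1 expr1n mulr1.
rewrite andbb mulr1n -(rmorph1 (real_complex R)) -rmorphD ltcR; apply.
apply/eqP => /(congr1 (mulmx P)); rewrite mulmxA PP mul1mx mulmx0.
by move/matrixP/(_ i 0); rewrite !mxE !eqxx => /eqP; rewrite oner_eq0.
Qed.

End Spectral1D.

Lemma retr_inv_gram n (L E : 'M[C]_n) : L \in unitmx ->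
  retr ((invmx L)^t* *m E *m invmx L) = retr (invmx (L^t* *m L) *m E).
Proof.
move=> uL; rewrite retrC mulmxA; congr (retr (_ *m _)).
have uLt : L^t* \in unitmx.
  by rewrite unitmxE det_trmxC unitfE conjC_eq0 -unitfE -unitmxE.
apply: (can_inj (mulKmx (_ : L^t* *m L \in unitmx))); rewrite ?unitmx_mul ?uL ?uLt //.
rewrite mulmxV ?unitmx_mul ?uL ?uLt // trmxCV !mulmxA mulmxK //.
by rewrite mulmxV.
Qed.

Lemma congrK n (L E : 'M[C]_n) : L \in unitmx ->
  L^t* *m ((invmx L)^t* *m E *m invmx L) *m L = E.
Proof.
move=> uL; rewrite !mulmxA mulmxKV // -trmxC_mul mulVmx //.
by rewrite trmxC1 mul1mx.
Qed.

Lemma herm_congr n p (E : 'M[C]_n) (B : 'M[C]_(n, p)) :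
  E \is hermsymmx -> B^t* *m E *m B \is hermsymmx.
Proof. by move/hermP => hE; apply/hermP; rewrite !trmxC_mul trmxCK hE mulmxA. Qed.

Lemma hermB n (A B : 'M[C]_n) :
  A \is hermsymmx -> B \is hermsymmx -> A - B \is hermsymmx.
Proof. by move=> /hermP hA /hermP hB; apply/hermP; rewrite trmxCB hA hB. Qed.

(** Factoring [A = L^H L] and whitening gives [B = L^H (1 + E) L]; on the eigenvalues of [E] the
    claim is [ln (1 + l) <= l]. *)
Lemma logdet_grad n (A B : 'M[C]_n) : posdefmx A -> posdefmx B ->
  logdet B <= logdet A + retr (invmx A *m (B - A)).
Proof.
move=> pdA pdB; have [L uL EA] := pd_factor pdA.
have hBA := herm_congr (invmx L) (hermB pdB.1 pdA.1).
pose E := (invmx L)^t* *m (B - A) *m invmx L.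
have EE : (invmx L)^t* *m B *m invmx L = 1%:M + E.
  rewrite /E mulmxBr mulmxBl [in X in _ = _ + (_ - X)]EA.
  rewrite mulmxA -trmxC_mul mulmxV // trmxC1 mul1mx mulmxV //.
  by rewrite addrCA subrr addr0.
have pd1E : posdefmx (1%:M + E).
  by rewrite -EE; apply: pd_congr_unit => //; rewrite unitmx_inv.
have [P [l [PP PP' El]]] := herm_spectral hBA.
have BE : B = L^t* *m (1%:M + E) *m L by rewrite -EE congrK.
rewrite [in X in X <= _]BE logdet_congr ?pd_det_gt0 // EA lerD2l.
rewrite -retr_inv_gram // -EA -/E.
rewrite -/E in El; move: pd1E; rewrite El => pd1E.
have l0 := pd_1D_spectral PP pd1E.
rewrite retr_spectral // /logdet det_1D_spectral //= ln_prod //.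
by apply: ler_sum => i _; apply: le_ln1Dx; rewrite -subr_gt0 opprK addrC.
Qed.

(** Same whitening as for the tangent bound, with [ln1D_ge] applied to each eigenvalue of the
    whitened perturbation. *)
Lemma logdet_second_order n (A E : 'M[C]_n) : posdefmx A -> E \is hermsymmx ->
  exists (c e : R), [/\ 0 <= c, 0 < e & forall t, 0 <= t <= e ->
    logdet A + t * retr (invmx A *m E) - c * t ^+ 2 <= logdet (A + t%:C *: E)].
Proof.
move=> pdA hE; have [L uL EA] := pd_factor pdA.
have [P [l [PP PP' El]]] := herm_spectral (herm_congr (invmx L) hE).
pose s := \sum_i l 0 i ^+ 2.
have s0 : 0 <= s by apply: sumr_ge0 => i _; apply: sqr_ge0.
(* Since [s] bounds every [l_i^2], one has [- (1 + s) <= l_i]; the range of [t] then keeps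
   [t l_i >= - 1/2], as [ln1D_ge] requires. *)
exists (2 * s), (2 * (1 + s))^-1; split; first by rewrite mulr_ge0.
  by rewrite invr_gt0 mulr_gt0 // ltr_pwDl.
move=> t /andP[t0 te].
have tl i : - 2^-1 <= t * l 0 i.
  have ls : l 0 i ^+ 2 <= s.
    by rewrite /s (bigD1 i) //= lerDl sumr_ge0 // => j _; apply: sqr_ge0.
  have te' : t * (2 * (1 + s)) <= 1.
    by move: te; rewrite -[X in t <= X]mul1r ler_pdivlMr // mulr_gt0 // ltr_pwDl.
  have : - (1 + s) <= l 0 i by nra.
  by move/(ler_wpM2l t0) => h; rewrite (le_trans _ h) //; lra.
have tE : (invmx L)^t* *m (t%:C *: E) *m invmx L =
    P^t* *m diag_mx (map_mx (real_complex R) (t *: l)) *m P.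
  rewrite -scalemxAr -scalemxAl El map_mxZ linearZ /=.
  by rewrite -scalemxAr -scalemxAl.
have EAt : A + t%:C *: E = L^t* *m (1%:M + (invmx L)^t* *m (t%:C *: E) *m invmx L) *m L.
  by rewrite mulmxDr mulmxDl mulmx1 congrK // -EA.
have l0 i : 0 < 1 + (t *: l) 0 i by rewrite mxE; have := tl i; lra.
rewrite EAt tE logdet_congr //; last first.
  by rewrite det_1D_spectral // ltcR prodr_gt0.
rewrite -EA -addrA lerD2l -retrZ scalemxAr {1}EA -retr_inv_gram // tE retr_spectral //.
rewrite /logdet det_1D_spectral //= ln_prod //.
have -> : 2 * s * t ^+ 2 = \sum_i 2 * (t *: l) 0 i ^+ 2.
  by rewrite /s mulr_sumr mulr_suml; apply: eq_bigr => i _; rewrite mxE; ring.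
by rewrite -sumrB; apply: ler_sum => i _; apply: ln1D_ge; rewrite mxE.
Qed.

(** Tangent bound at [A + B], evaluated at [A]: the linear term is minus the pairing of two positive
    semidefinite matrices. *)
Lemma logdet_mono n (A B : 'M[C]_n) :
  posdefmx A -> psdmx B -> logdet A <= logdet (A + B).
Proof.
move=> pdA psB; have pdAB := pdDpsd pdA psB.
apply: le_trans (logdet_grad pdAB pdA) _.
rewrite opprD addrA subrr add0r mulmxN -[X in _ <= X]addr0 lerD2l.
rewrite /retr raddfN raddfN oppr_le0.
exact: psd_mul_retr_ge0 (pd_psd (pd_inv pdAB)) psB.
Qed.

(** Both values are bounded by the tangent at the convex combination [Z], where the weighted linear
    terms cancel. *)
Lemma logdet_concave n (t : R) (A B : 'M[C]_n) : 0 <= t <= 1 ->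
  posdefmx A -> posdefmx B ->
  t * logdet A + (1 - t) * logdet B <= logdet (t%:C *: A + (1 - t)%:C *: B).
Proof.
move=> t01 pdA pdB; have pdC := pd_convex t01 pdA pdB.
set Z := _ + _ in pdC *; have /andP[t0 t1] := t01.
have tE : t + (1 - t) = 1 by rewrite addrC subrK.
have /(ler_wpM2l t0) hA := logdet_grad pdC pdA.
have /(ler_wpM2l (_ : 0 <= 1 - t)) hB := logdet_grad pdC pdB.
rewrite subr_ge0 in hB; apply: le_trans (lerD hA (hB t1)) _.
rewrite !mulrDr addrACA -mulrDl tE mul1r -!retrZ -retrD.
rewrite !scalemxAr -mulmxDr (_ : t%:C *: (A - Z) + (1 - t)%:C *: (B - Z) = 0).
  by rewrite mulmx0 /retr mxtrace0 addr0.
rewrite !scalerBr addrACA -opprD -scalerDl -rmorphD tE rmorph1.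
by rewrite scale1r subrr.
Qed.

End LogDet.

(** * Convexity of the log-determinant ratio through linear estimation *)

Section LogDetRatio.
Local Open Scope complex_scope.
Context {R : realType}.
Local Notation C := R[i].

Lemma invmx_uniq n (A B : 'M[C]_n) : A *m B = 1%:M -> invmx A = B.
Proof. by move=> AB; have [uA _] := mulmx1_unit AB; rewrite -[LHS]mulmx1 -AB mulKmx. Qed.

Lemma logdet_inv n (A : 'M[C]_n) : posdefmx A -> logdet (invmx A) = - logdet A.
Proof.
move=> pdA; apply/eqP; rewrite -addr_eq0.
rewrite -(logdetM (pd_det_gt0 (pd_inv pdA)) (pd_det_gt0 pdA)).
by rewrite (mulVmx (pd_unit pdA)) /logdet det1 ln1.
Qed.

(* Error covariance of the linear estimator X^H of a unit-covariance signal
   observed through L^H in noise of covariance A. *)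
Definition mmse n (L X A : 'M[C]_n) : 'M[C]_n :=
  (1%:M - L *m X)^t* *m (1%:M - L *m X) + X^t* *m A *m X.

(** The matrix is a Gram matrix [Z^H Z]; on the kernel of [K X], which is that of [X], the other
    block [1 - L X] acts as the identity, so [Z] is injective. *)
Lemma mmse_pd n (L X A : 'M[C]_n) : posdefmx A -> posdefmx (mmse L X A).
Proof.
move=> pdA; have [K uK ->] := pd_factor pdA.
pose Z := col_mx (1%:M - L *m X) (K *m X).
have -> : mmse L X (K^t* *m K) = Z^t* *m 1%:M *m Z.
  rewrite mulmx1 /Z tr_col_mx map_row_mx mul_row_col /mmse.
  by rewrite [in RHS]trmxC_mul !mulmxA.
apply: pd_congr (pd1 _) _ => x; rewrite /Z mul_col_mx -[0]vsubmxK.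
move=> /eq_col_mx []; rewrite !linear0 => h1 h2.
have Xx : X *m x = 0.
  by rewrite -[LHS](mulKmx uK) [K *m _]mulmxA h2 mulmx0.
by move: h1; rewrite mulmxBl mul1mx -mulmxA Xx mulmx0 subr0.
Qed.

Lemma mmse_affine n (L X A B : 'M[C]_n) (t : R) :
  mmse L X (t%:C *: A + (1 - t)%:C *: B) =
  t%:C *: mmse L X A + (1 - t)%:C *: mmse L X B.
Proof.
rewrite /mmse !scalerDr addrACA -scalerDl -rmorphD (_ : t + (1 - t) = 1).
  rewrite rmorph1 scale1r [X^t* *m (_ + _)]mulmxDr [(_ + _) *m X]mulmxDl.
  by rewrite -!scalemxAr -!scalemxAl.
by rewrite addrC subrK.
Qed.

(** The Wiener filter; it minimizes [mmse L X A] over [X] by [mmseE]. *)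
Definition mmse_opt n (L A : 'M[C]_n) := invmx (A + L^t* *m L) *m L^t*.

(** Completion of the square in [X], using the normal equation [M *m mmse_opt L A = L^t*]. *)
Lemma mmseE n (L X A : 'M[C]_n) (M := A + L^t* *m L) : posdefmx A ->
  mmse L X A = 1%:M - L *m invmx M *m L^t* +
    (X - mmse_opt L A)^t* *m M *m (X - mmse_opt L A).
Proof.
move=> pdA; have pdM : posdefmx M := pdDpsd pdA (gram_psd L).
have uM := pd_unit pdM; have /hermP hM := pdM.1.
have LX : M *m mmse_opt L A = L^t* by rewrite mulKVmx.
have XL : (mmse_opt L A)^t* *m M = L by rewrite -[X in _ *m X]hM -trmxC_mul LX trmxCK.
rewrite mulmxBr -[X in _ = _ + (_ - X)]mulmxA LX trmxCB !mulmxBl XL.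
rewrite trmxC_mul trmxCK trmxCV hM.
rewrite /mmse trmxCB trmxC1 trmxC_mul mulmxBl mul1mx mulmxBr mulmx1.
have -> : X^t* *m M *m X = X^t* *m A *m X + X^t* *m L^t* *m (L *m X).
  by rewrite /M mulmxDr mulmxDl !mulmxA.
rewrite -[_ *m _ *m L^t*]mulmxA.
move: (1%:M) (L *m (invmx _ *m _)) (L *m X) => o f a.
move: (X^t* *m A *m X) (X^t* *m L^t*) => e b; move: (b *m a) => c.
by apply/matrixP => i j; rewrite !mxE; ring.
Qed.

(** Sylvester's identity replaces [1 - L M^-1 L^H] by [1 - M^-1 L^H L], which is [M^-1 A]. *)
Lemma logdet_mmse_opt n (L A : 'M[C]_n) (M := A + L^t* *m L) : posdefmx A ->
  logdet (mmse L (mmse_opt L A) A) = logdet A - logdet M.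
Proof.
move=> pdA; have pdM : posdefmx M := pdDpsd pdA (gram_psd L).
rewrite mmseE // subrr mulmx0 addr0 -/M -mulmxA.
rewrite -(logdet_inv pdM) [RHS]addrC.
rewrite -(logdetM (pd_det_gt0 (pd_inv pdM)) (pd_det_gt0 pdA)).
rewrite {1}/logdet det_1subC -mulmxA.
have {1}-> : L^t* *m L = M - A by rewrite /M addrC addKr.
by rewrite mulmxBr (mulVmx (pd_unit pdM)) subKr.
Qed.

(* The ratio is the maximum over [X] of [- logdet (mmse L X A)], convex in [A]
   because [mmse] is affine in [A]. *)
Lemma logdet_ratio_convex n (t : R) (A B F : 'M[C]_n)
    (Z := t%:C *: A + (1 - t)%:C *: B) : 0 <= t <= 1 ->
  posdefmx A -> posdefmx B -> psdmx F ->
  logdet (Z + F) - logdet Z <=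
  t * (logdet (A + F) - logdet A) + (1 - t) * (logdet (B + F) - logdet B).
Proof.
move=> t01 pdA pdB /psd_factor [L ->].
have pdZ : posdefmx Z by apply: pd_convex.
pose X := mmse_opt L Z.
(* A fixed filter does no better than [mmse_opt L E], because the completed square is positive
   semidefinite; at [Z] the filter [X] attains the bound. *)
have bound E : posdefmx E -> - logdet (mmse L X E) <= logdet (E + L^t* *m L) - logdet E.
  move=> pdE; rewrite lerNl opprB -(logdet_mmse_opt L pdE).
  rewrite (mmseE L X pdE) (mmseE L (mmse_opt L E) pdE) subrr mulmx0 addr0.
  apply: logdet_mono; last first.
    exact: psd_congr (pd_psd (pdDpsd pdE (gram_psd L))).
  by have := mmse_pd L (mmse_opt L E) pdE; rewrite (mmseE _ _ pdE) subrr mulmx0 addr0.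
have -> : logdet (Z + L^t* *m L) - logdet Z = - logdet (mmse L X Z).
  by rewrite (logdet_mmse_opt L pdZ) opprB.
have /andP[t0 t1] := t01.
have /(ler_wpM2l t0) hA := bound _ pdA.
have /(ler_wpM2l (_ : 0 <= 1 - t)) hB := bound _ pdB.
rewrite subr_ge0 in hB; apply: le_trans (lerD hA (hB t1)).
rewrite !mulrN -opprD lerN2 mmse_affine.
exact: logdet_concave t01 (mmse_pd L X pdA) (mmse_pd L X pdB).
Qed.

End LogDetRatio.

(** * A single user *)

Section SingleUser.
Local Open Scope complex_scope.
Context {R : realType}.
Local Notation C := R[i].
Variables (m p : nat) (Om W : 'M[C]_p) (Ht : 'M[C]_(m, p)).
Variables (U : 'M[C]_m) (d : 'rV[R]_m) (V : 'M[C]_(p, m)) (Q : 'M[C]_m) (mu : R).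
Hypotheses (hW : W^t* = W) (WOW : W *m Om *m W = 1%:M).
Hypotheses (svd : is_svd (Ht *m W) U d V) (psQ : psdmx Q).

(** Whitening by [W] turns [Om] into the identity and [F] into [V *m Y *m V^t*]; [Q1] is [Q] in the
    left singular basis. *)
Let D := diag_mx (map_mx (real_complex R) d).
Let Q1 := U^t* *m Q *m U.
Let Y := D *m Q1 *m D.
Let T := invmx (1%:M + Y).
Let F := Ht^t* *m Q *m Ht.
Let X := Ht *m invmx (Om + F) *m Ht^t*.
Let S := W *m V *m U^t* *m Q *m U *m V^t* *m W.

Let UU : U *m U^t* = 1%:M.
Proof. by have [/unitarymxP] := svd. Qed.

Let UU' : U^t* *m U = 1%:M.
Proof. exact: mulmx1C UU. Qed.

Let VV : V^t* *m V = 1%:M.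
Proof. by have [] := svd. Qed.

Let HtW : Ht *m W = U *m D *m V^t*.
Proof. by have [] := svd. Qed.

Let hD : D^t* = D.
Proof. exact: trmxC_real_diag. Qed.

Let WHt : W *m Ht^t* = V *m D *m U^t*.
Proof. by rewrite -[W in LHS]hW -trmxC_mul HtW !trmxC_mul trmxCK hD mulmxA. Qed.

Let psQ1 : psdmx Q1.
Proof. exact: psd_congr. Qed.

Let hQ1 : Q1^t* = Q1.
Proof. by apply/hermP; have [] := psQ1. Qed.

Let psY : psdmx Y.
Proof. by rewrite /Y -[X in X *m Q1 *m _]hD; apply: psd_congr. Qed.

Let u1Y : 1%:M + Y \in unitmx.
Proof. exact: pd_unit (pdDpsd (pd1 m) psY). Qed.

Let TY : T *m Y = 1%:M - T.
Proof.
have := mulVmx u1Y; rewrite -/T mulmxDr mulmx1 => <-.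
by rewrite addrC addKr.
Qed.

Let YT : Y *m T = 1%:M - T.
Proof.
have := mulmxV u1Y; rewrite -/T mulmxDl mul1mx => <-.
by rewrite addrC addKr.
Qed.

Let hT : T^t* = T.
Proof.
rewrite /T trmxCV trmxCD trmxC1; congr (invmx (_ + _)).
by apply/hermP; have [] := psY.
Qed.

Let WWOm : W *m W *m Om = 1%:M.
Proof. by rewrite -mulmxA; apply: mulmx1C. Qed.

Let S_E : S = W *m (V *m Q1 *m V^t*) *m W.
Proof. by rewrite /S /Q1 !mulmxA. Qed.

(** The inverse of [1%:M + V *m Y *m V^t*]: it acts as [T] on the range of [V] and as the identity
    on the orthogonal complement. *)
Let Z := 1%:M - V *m (1%:M - T) *m V^t*.

Let VZ : V^t* *m Z = T *m V^t*.
Proof. by rewrite /Z mulmxBr mulmx1 !mulmxA VV mul1mx mulmxBl mul1mx subKr. Qed.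

Let invOmF : invmx (Om + F) = W *m Z *m W.
Proof.
(* Moving the last [W] to the front leaves [W *m (Om + F) *m W *m Z = 1%:M]. *)
apply: invmx_uniq; rewrite 2!mulmxA; apply: mulmx1C; rewrite !mulmxA.
have -> : W *m (Om + F) *m W = 1%:M + V *m Y *m V^t*.
  rewrite mulmxDr mulmxDl WOW /F !mulmxA WHt -(mulmxA _ Ht W) HtW.
  by rewrite /Y /Q1 !mulmxA.
rewrite mulmxDl mul1mx -[V *m Y *m _ *m Z]mulmxA VZ mulmxA -(mulmxA V) YT.
by rewrite subrK.
Qed.

Let VZV : V^t* *m Z *m V = T.
Proof. by rewrite VZ -mulmxA VV mulmx1. Qed.

Let X_E : X = U *m (D *m T *m D) *m U^t*.
Proof.
rewrite /X invOmF !mulmxA HtW -(mulmxA _ W (Ht^t*)) WHt.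
by rewrite -VZV !mulmxA.
Qed.

Let retr_Q1 : retr Q1 = retr Q.
Proof. by rewrite /Q1 -mulmxA retrC -mulmxA UU mulmx1. Qed.

(** By cyclicity [Om] cancels the whitening and [V] drops out as an isometry: priced by [Om], the
    covariance [S] costs the power of [Q]. *)
Lemma retr_user : retr (S *m Om) = retr Q.
Proof.
rewrite S_E; set B := V *m Q1 *m V^t*.
rewrite -(mulmxA (W *m B)) -(mulmxA W) retrC -(mulmxA B) WOW mulmx1.
by rewrite /B -mulmxA retrC -mulmxA VV mulmx1.
Qed.

Hypotheses (mu0 : 0 < mu) (XQ : X *m Q = mu%:C *: Q).

Let DTD_E : D *m T *m D = U^t* *m X *m U.
Proof. by rewrite X_E !mulmxA UU' mul1mx -(mulmxA _ (U^t*)) UU' mulmx1. Qed.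

Let DTDQ : D *m T *m D *m Q1 = mu%:C *: Q1.
Proof.
rewrite DTD_E /Q1 -[U^t* *m Q *m U]mulmxA (mulmxA _ (U^t*)).
rewrite -(mulmxA _ U) UU mulmx1.
rewrite -(mulmxA _ X) (mulmxA X) XQ.
by rewrite -scalemxAl -scalemxAr.
Qed.

(** Stationarity and [TY] make [mu Q1 D^2] equal to the Hermitian matrix [D^2 - D T D]. Hence [Q1]
    commutes with [D^2], and with [D] because the singular values are nonnegative. *)
Let Q1D : Q1 *m D = D *m Q1.
Proof.
have e : D *m D - D *m T *m D = mu%:C *: (Q1 *m D *m D).
  rewrite 2!scalemxAl -DTDQ.
  have -> : D *m T *m D *m Q1 *m D = D *m (T *m Y) by rewrite /Y !mulmxA.
  by rewrite TY mulmxBr mulmx1 mulmxBl.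
have e2 : Q1 *m D *m D = D *m (D *m Q1).
  have mu1 : mu%:C != 0 :> C by rewrite gt_eqF // ltcR.
  apply: (scalerI mu1); rewrite -e.
  have := congr1 (fun B => B^t*) e; rewrite /= trmxCZ 2!trmxC_mul hQ1 hD => <-.
  by rewrite trmxCB !trmxC_mul hD hT mulmxA.
apply/matrixP => i j; move/matrixP/(_ i j): e2.
rewrite /D !mul_mx_diag !mul_diag_mx !mxE; move: (\sum__ _) => q e3.
(* The entry [q] satisfies [q (d_j - d_i) (d_j + d_i) = 0]; for distinct nonnegative [d_i], [d_j]
   neither of the last two factors vanishes. *)
have [_ _ d0 _] := svd; have [->|dij] := eqVneq (d 0 i) (d 0 j); first exact: mulrC.
have : q * ((d 0 j)%:C - (d 0 i)%:C) * ((d 0 j)%:C + (d 0 i)%:C) = 0.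
  by rewrite -[RHS](subrr (q * (d 0 j)%:C * (d 0 j)%:C)) {2}e3; ring.
rewrite -rmorphB -rmorphD; move/eqP; rewrite !mulf_eq0 !fmorph_eq0.
rewrite subr_eq0 [d 0 j == _]eq_sym (negbTE dij) orbF paddr_eq0 //.
case/orP => [/eqP -> |/andP[/eqP dj /eqP di]]; first by rewrite mul0r mulr0.
by rewrite di dj eqxx in dij.
Qed.

Let DT : T *m D = D *m T.
Proof.
have YD : Y *m D = D *m Y.
  by rewrite /Y [RHS]mulmxA -(mulmxA D Q1 D) Q1D.
rewrite -[LHS]mulmx1 -(mulmxV u1Y) -/T mulmxA -(mulmxA T D).
have -> : D *m (1%:M + Y) = (1%:M + Y) *m D.
  by rewrite mulmxDr mulmxDl mulmx1 mul1mx YD.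
by rewrite mulmxA (mulVmx u1Y) mul1mx.
Qed.

(** Here [1 - T = T Y = T D Q1 D]; commuting [D] past [Q1] and [T] gives [D T D Q1], which
    stationarity evaluates. *)
Let T_E : 1%:M - T = mu%:C *: Q1.
Proof. by rewrite -TY -DTDQ -DT /Y -(mulmxA D Q1 D) Q1D (mulmxA T) (mulmxA (T *m D)). Qed.

Lemma invB_user : invmx Om - invmx (Om + F) = mu%:C *: S.
Proof.
have -> : invmx Om = W *m W by apply: invmx_uniq; apply: mulmx1C.
rewrite invOmF /Z mulmxBr mulmxBl mulmx1 subKr T_E S_E.
by rewrite -!scalemxAr -!scalemxAl -scalemxAr -scalemxAl.
Qed.

Lemma psd_user : psdmx S.
Proof.
rewrite S_E -[X in X *m _ *m W]hW; apply: psd_congr; exact: psd_congrC.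
Qed.

Lemma rank_user : (\rank S <= m)%N.
Proof.
rewrite /S -!mulmxA; apply: leq_trans (mxrankM_maxr _ _) _.
by apply: leq_trans (mxrankM_maxl _ _) _; rewrite rank_leq_col.
Qed.

Hypothesis (Xmu : psdmx (mu%:C *: 1%:M - X)).

(* Weak duality with dual variable [mu * Omega]. *)
Lemma duality_user (S' : 'M[C]_p) : psdmx S' ->
  logdet (1%:M + Ht *m S' *m Ht^t*) <=
  logdet (1%:M + Ht *m S *m Ht^t*) + mu * (retr (S' *m Om) - retr Q).
Proof.
move=> psS'.
have eS : 1%:M + Ht *m S *m Ht^t* = U *m (1%:M + Y) *m U^t*.
  rewrite S_E !mulmxA HtW -(mulmxA _ W (Ht^t*)) WHt mulmxDr mulmx1 mulmxDl UU.
  congr (_ + _); rewrite /Y !mulmxA -(mulmxA _ (V^t*) V) VV mulmx1.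
  by rewrite -(mulmxA _ (V^t*) V) VV mulmx1.
have pdS : posdefmx (1%:M + Ht *m S *m Ht^t*).
  by apply: pdDpsd (pd1 _) _; apply: psd_congrC; apply: psd_user.
have pdS' : posdefmx (1%:M + Ht *m S' *m Ht^t*).
  by apply: pdDpsd (pd1 _) _; apply: psd_congrC.
apply: le_trans (logdet_grad pdS pdS') _; rewrite lerD2l.
have -> : invmx (1%:M + Ht *m S *m Ht^t*) = U *m T *m U^t*.
  apply: invmx_uniq; rewrite eS !mulmxA -(mulmxA _ (U^t*) U) UU' mulmx1.
  by rewrite -(mulmxA U) (mulmxV u1Y) mulmx1 UU.
(* The gradient at [S] of the single-user objective. *)
set G := Ht^t* *m (U *m T *m U^t*) *m Ht.
have -> : retr (U *m T *m U^t* *m (1%:M + Ht *m S' *m Ht^t* -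
    (1%:M + Ht *m S *m Ht^t*))) = retr (G *m S') - retr (G *m S).
  rewrite opprD addrACA subrr add0r mulmxBr retrB.
  by congr (_ - _); rewrite /G !mulmxA retrC !mulmxA.
have WGW : W *m G *m W = V *m (D *m T *m D) *m V^t*.
  rewrite /G !mulmxA WHt -(mulmxA _ Ht W) HtW !mulmxA.
  by rewrite -(mulmxA _ (U^t*) U) UU' mulmx1 -(mulmxA _ (U^t*) U) UU' mulmx1.
have -> : retr (G *m S) = mu * retr Q.
  have cyc (A B : 'M[C]_p) : retr (A *m (W *m B *m W)) = retr (W *m A *m W *m B).
    by rewrite mulmxA retrC !mulmxA.
  rewrite S_E cyc WGW -[V *m Q1 *m _]mulmxA mulmxA -(mulmxA _ (V^t*) V) VV mulmx1.
  rewrite mulmxA retrC -(mulmxA V) (mulmxA (V^t*)) VV mul1mx DTDQ retrZ.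
  by rewrite retr_Q1.
have uW : W \in unitmx by move: WWOm; rewrite -mulmxA => /mulmx1_unit [].
(* Dual feasibility [G <= mu Om]: after whitening, [Xmu] gives it on the range of [V], and on the
   orthogonal complement only [mu] times the identity remains. *)
have psN : psdmx (mu%:C *: Om - G).
  have -> : mu%:C *: Om - G =
      (invmx W)^t* *m (W *m (mu%:C *: Om - G) *m W) *m invmx W.
    by rewrite trmxCV hW -(mulmxA W) (mulKmx uW) (mulmxK uW).
  apply: psd_congr; rewrite mulmxBr mulmxBl -scalemxAr -scalemxAl WOW WGW.
  have -> : mu%:C *: 1%:M - V *m (D *m T *m D) *m V^t* =
      mu%:C *: (1%:M - V *m V^t*) +
      V *m (U^t* *m (mu%:C *: 1%:M - X) *m U) *m V^t*.
    rewrite [U^t* *m _]mulmxBr mulmxBl -scalemxAr -scalemxAl mulmx1 UU'.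
    rewrite -DTD_E mulmxBr mulmxBl -scalemxAr -scalemxAl mulmx1 scalerBr.
    by rewrite addrA subrK.
  apply: psdD; last exact: psd_congrC (psd_congr _ Xmu).
  apply: psdZ; first exact: ltW.
  have -> : 1%:M - V *m V^t* = (1%:M - V *m V^t*)^t* *m (1%:M - V *m V^t*).
    rewrite trmxCB trmxC1 trmxC_mul trmxCK mulmxBr mulmx1 mulmxBl mul1mx.
    by rewrite mulmxA -(mulmxA V) VV mulmx1 subrr subr0.
  exact: gram_psd.
have := psd_mul_retr_ge0 psN psS'.
by rewrite mulmxBl retrB -scalemxAl retrZ (retrC Om) subr_ge0 mulrBr lerD2r.
Qed.

End SingleUser.

(** * First-order conditions *)

Section SecondOrder.
Context {R : realType}.

(** A one-sided first-order bound at [0], in place of a right derivative at most [D]; taking [t = 0]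
    it forces [f 0 <= 0]. *)
Definition quad_ub (f : R -> R) (D : R) : Prop :=
  exists c e : R, [/\ 0 <= c, 0 < e &
    forall t, 0 <= t <= e -> f t <= t * D + c * t ^+ 2].

Lemma quad_ub_sum (J : finType) (f : J -> R -> R) (D : J -> R) :
  (forall j, quad_ub (f j) (D j)) ->
  quad_ub (fun t => \sum_j f j t) (\sum_j D j).
Proof.
move=> h; elim: (index_enum J) => [|j r [c [e [c0 e0 le]]]].
  exists 0, 1; split=> // t _; rewrite !big_nil mulr0 mul0r addr0.
  exact: lexx.
have [c' [e' [c'0 e'0 le']]] := h j.
exists (c' + c), (Order.min e' e); split; first exact: addr_ge0.
  by rewrite lt_min e'0 e0.
move=> t /andP[t0]; rewrite le_min => /andP[te' te]; rewrite !big_cons.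
have l1 : f j t <= t * D j + c' * t ^+ 2 by apply: le'; rewrite t0.
have l2 := le t; rewrite t0 te in l2; have {}l2 := l2 isT.
apply: le_trans (lerD l1 l2) _.
by rewrite addrACA -mulrDr -mulrDl.
Qed.

Lemma quad_ub_ge0 (f : R -> R) (D : R) : quad_ub f D ->
  (forall t, 0 <= t < 1 -> 0 <= f t) -> 0 <= D.
Proof.
move=> [c [e [c0 e0 le]]] f0; rewrite leNgt; apply/negP => D0.
(* The three bounds put [t] in the range of the estimate, keep it below [1], and give
   [c t <= - D / 2], so that [f t <= t D / 2 < 0]. *)
pose t := Order.min (Order.min e 2^-1) (- D / (2 * (c + 1))).
have c1 : 0 < 2 * (c + 1) by lra.
have t0 : 0 < t.
  rewrite !lt_min e0 divr_gt0 ?oppr_gt0 // andbT.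
  by rewrite invr_gt0 ltr0n.
have [te t2 tc] : [/\ t <= e, t <= 2^-1 & t * (2 * (c + 1)) <= - D].
  split; first by rewrite !ge_min lexx.
  - by rewrite !ge_min lexx orbT.
  - by rewrite -ler_pdivlMr // ge_min lexx orbT.
have h1 : f t <= t * D + c * t ^+ 2 by apply: le; rewrite (ltW t0).
have h2 : 0 <= f t by apply: f0; rewrite (ltW t0) /=; lra.
nra.
Qed.

Lemma quad_ubB a a' b b' t x y s : a' <= a + t * x -> b + t * y - s <= b' ->
  a' - b' - (a - b) <= t * (x - y) + s :> R.
Proof. by move=> ? ?; lra. Qed.

Lemma quad_ubN a b t x y : a + t * x - y <= b -> a - b <= t * - x + y :> R.
Proof. by move=> ?; lra. Qed.

Lemma convex_comb_le t a b c : 0 <= t <= 1 -> a <= c -> b <= c ->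
  (1 - t) * a + t * b <= c :> R.
Proof.
move=> /andP[t0 t1] /(ler_wpM2l (_ : 0 <= 1 - t)) h /(ler_wpM2l t0) h2.
by rewrite subr_ge0 in h; move: (h t1); lra.
Qed.

End SecondOrder.

Lemma sum_dfwith (Z : nmodType) (J : finType) (T : J -> Type)
    (z : forall j, T j) k (x : T k) (g : forall j, T j -> Z) :
  (forall j, j != k -> g j (z j) = 0) -> \sum_j g j (dfwith z x j) = g k x.
Proof.
move=> g0; rewrite (bigD1 k) //= dfwith_in big1 ?addr0 // => j jk.
by rewrite dfwith_out ?g0 // eq_sym.
Qed.

(** * Convexity of the minimax objective *)

Section NetworkLemmas.
Local Open Scope complex_scope.
Context {R : realType} {K M N : nat} {n : 'I_K -> nat} {nt : 'I_M -> nat}.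
Local Notation C := R[i].
Variables (H : forall k, 'M[C]_(n k, N)) (G : forall m, 'M[C]_(nt m, N)).
Variable Vb : forall k, 'M[C]_(N, @nbar K N n k).

Local Notation Om := (Omega G Vb).
Local Notation Ht := (Htilde H Vb).
Local Notation F Q k := ((Ht k)^t* *m Q k *m Ht k).

Lemma Lambda_psd (psi : 'cV[R]_(N + M)) :
  (forall i, 0 <= psi i 0) -> psdmx (Lambda G psi).
Proof.
move=> psi0; apply: psdD; last first.
  by apply: psd_sum => m _; apply: psdZ (gram_psd _); rewrite mxE.
split=> [|x].
  have -> : \row_j (usubmx psi j 0)%:C = map_mx (real_complex R) (\row_j usubmx psi j 0).
    by apply/rowP => j; rewrite !mxE.
  by apply/hermP; apply: trmxC_real_diag.
rewrite diag_qform sumr_ge0 // => j _.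
by rewrite mulr_ge0 ?exprn_ge0 // !mxE ler0c.
Qed.

Lemma Omega_psd (psi : 'cV[R]_(N + M)) k :
  (forall i, 0 <= psi i 0) -> psdmx (Om psi k).
Proof. by move=> /Lambda_psd; apply: psd_congr. Qed.

Lemma Omega_pd (psi : 'cV[R]_(N + M)) k : psi_domain G Vb psi -> posdefmx (Om psi k).
Proof. by move=> [psi0 uO]; apply: psd_unit_pd (Omega_psd _ psi0) (uO k). Qed.

Lemma OmegaD (a b : R) (x y : 'cV[R]_(N + M)) k :
  Om (a *: x + b *: y) k = a%:C *: Om x k + b%:C *: Om y k.
Proof.
rewrite /Omega; suff -> : Lambda G (a *: x + b *: y) =
    a%:C *: Lambda G x + b%:C *: Lambda G y.
  by rewrite mulmxDr mulmxDl -2!scalemxAr -2!scalemxAl.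
rewrite /Lambda !scalerDr addrACA; congr (_ + _).
  rewrite -!linearZ -linearD /=; congr diag_mx; apply/rowP => j.
  by rewrite !mxE rmorphD !rmorphM.
rewrite !scaler_sumr -big_split /=; apply: eq_bigr => m _.
by rewrite !scalerA -scalerDl !mxE rmorphD !rmorphM.
Qed.

(** Both determinants are positive on the domain, so real part and logarithm split along the
    quotient. *)
Lemma ftildeE (psi : 'cV[R]_(N + M)) Q : psi_domain G Vb psi -> Q_domain Q ->
  ftilde H G Vb psi Q = \sum_k (logdet (Om psi k + F Q k) - logdet (Om psi k)).
Proof.
move=> dpsi dQ; apply: eq_bigr => k _.
have pO := Omega_pd k dpsi; have p1 := pd_det_gt0 pO.
have p2 := pd_det_gt0 (pdDpsd pO (psd_congr (Ht k) (dQ k))).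
have p1' := Re_gt0 p1; have p2' := Re_gt0 p2.
rewrite /logdet -(ReK (ltW p1)) -(ReK (ltW p2)) -fmorphV -rmorphM /=.
by rewrite lnM ?posrE ?invr_gt0 // lnV ?posrE.
Qed.

(** Only nonnegativity is asked of the endpoint [y], where some [Omega] may be singular: the weight
    [1 - t > 0] on [x] keeps the mixture positive definite. *)
Lemma psi_domain_mix (t : R) (x y : 'cV[R]_(N + M)) : 0 <= t < 1 ->
  psi_domain G Vb x -> (forall i, 0 <= y i 0) ->
  psi_domain G Vb ((1 - t) *: x + t *: y).
Proof.
move=> /andP[t0 t1] dx y0; split=> [i|k].
  rewrite !mxE addr_ge0 ?mulr_ge0 ?dx.1 ?y0 // subr_ge0; exact: ltW.
rewrite OmegaD; apply: pd_unit; apply: pdDpsd.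
  by apply: pdZ (Omega_pd k dx); rewrite subr_gt0.
exact: psdZ t0 (Omega_psd k y0).
Qed.

Lemma Q_domain_mix (t : R) (Q Q' : forall k, 'M[C]_(n k)) : 0 <= t <= 1 ->
  Q_domain Q -> Q_domain Q' ->
  Q_domain (fun k => t%:C *: Q k + (1 - t)%:C *: Q' k).
Proof.
move=> /andP[t0 t1] dQ dQ' k; apply: psdD; first exact: psdZ t0 (dQ k).
by apply: psdZ (dQ' k); rewrite subr_ge0.
Qed.

Lemma psi_domain_convex (t : R) (x y : 'cV[R]_(N + M)) : 0 <= t <= 1 ->
  psi_domain G Vb x -> psi_domain G Vb y ->
  psi_domain G Vb (t *: x + (1 - t) *: y).
Proof.
move=> t01 dx dy; have /andP[t0 t1] := t01; split=> [i|k].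
  by rewrite !mxE addr_ge0 ?mulr_ge0 ?dx.1 ?dy.1 // subr_ge0.
by rewrite OmegaD; apply: pd_unit; apply: pd_convex t01 (Omega_pd k dx) (Omega_pd k dy).
Qed.

Lemma ftilde_convex (t : R) (x y : 'cV[R]_(N + M)) Q : 0 <= t <= 1 ->
  psi_domain G Vb x -> psi_domain G Vb y -> Q_domain Q ->
  ftilde H G Vb (t *: x + (1 - t) *: y) Q <=
  t * ftilde H G Vb x Q + (1 - t) * ftilde H G Vb y Q.
Proof.
move=> t01 dx dy dQ; have dxy := psi_domain_convex t01 dx dy.
rewrite (ftildeE dxy dQ) (ftildeE dx dQ) (ftildeE dy dQ).
rewrite !mulr_sumr -big_split /=; apply: ler_sum => k _; rewrite OmegaD.
exact: logdet_ratio_convex t01 (Omega_pd k dx) (Omega_pd k dy) (psd_congr _ (dQ k)).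
Qed.

Lemma ftilde_concave (t : R) (psi : 'cV[R]_(N + M)) Q Q' : 0 <= t <= 1 ->
  psi_domain G Vb psi -> Q_domain Q -> Q_domain Q' ->
  t * ftilde H G Vb psi Q + (1 - t) * ftilde H G Vb psi Q' <=
  ftilde H G Vb psi (fun k => t%:C *: Q k + (1 - t)%:C *: Q' k).
Proof.
move=> t01 dpsi dQ dQ'; have dQQ := Q_domain_mix t01 dQ dQ'.
rewrite (ftildeE dpsi dQ) (ftildeE dpsi dQ') (ftildeE dpsi dQQ).
rewrite !mulr_sumr -big_split /=; apply: ler_sum => k _.
have aux (a b c e : R) : t * a + (1 - t) * b <= e ->
    t * (a - c) + (1 - t) * (b - c) <= e - c by move=> ?; lra.
apply: aux; have pO := Omega_pd k dpsi.
have := logdet_concave t01 (pdDpsd pO (psd_congr (Ht k) (dQ k)))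
  (pdDpsd pO (psd_congr (Ht k) (dQ' k))).
rewrite !scalerDr addrACA -scalerDl -rmorphD [t + _]addrC subrK rmorph1 scale1r.
by rewrite [_ *m (_ + _)]mulmxDr [(_ + _) *m Ht k]mulmxDl -!scalemxAr -!scalemxAl.
Qed.

End NetworkLemmas.

(** * Saddle points *)

Section Saddle.
Local Open Scope complex_scope.
Context {R : realType} {K M N : nat} {n : 'I_K -> nat} {nt : 'I_M -> nat}.
Local Notation C := R[i].
Variables (H : forall k, 'M[C]_(n k, N)) (G : forall m, 'M[C]_(nt m, N)).
Variable Vb : forall k, 'M[C]_(N, @nbar K N n k).

Local Notation Om := (Omega G Vb).
Local Notation Ht := (Htilde H Vb).
Local Notation F Q k := ((Ht k)^t* *m Q k *m Ht k).

(* Consumption of the power and interference budgets by the covariances S. *)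
Definition usage (S : forall k, 'M[C]_(@nbar K N n k)) : 'cV[R]_(N + M) :=
  col_mx (\col_j \sum_k complex.Re ((Vb k *m S k *m (Vb k)^t*) j j))
         (\col_m \sum_k complex.Re (\tr (Gtilde G Vb m k *m S k *m (Gtilde G Vb m k)^t*))).

(** Since [Lambda] is linear in [psi], the entries of [psi] act as prices of the individual power
    and interference budgets. *)
Lemma usageE (S : forall k, 'M[C]_(@nbar K N n k)) (psi : 'cV[R]_(N + M)) :
  \sum_k retr (S k *m Om psi k) = ((usage S)^T *m psi) 0 0.
Proof.
rewrite /usage -[psi in RHS]vsubmxK tr_col_mx mul_row_col mxE [in RHS]mxE [X in _ = _ + X]mxE.
have e k : retr (S k *m Om psi k) =
    \sum_j complex.Re ((Vb k *m S k *m (Vb k)^t*) j j) * usubmx psi j 0 +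
    \sum_m complex.Re (\tr (Gtilde G Vb m k *m S k *m (Gtilde G Vb m k)^t*)) * dsubmx psi m 0.
  rewrite retrC /Omega -!mulmxA retrC -!mulmxA /Lambda mulmxDl retrD.
  set B := Vb k *m _; congr (_ + _).
    rewrite mul_diag_mx /retr /mxtrace raddf_sum /=; apply: eq_bigr => j _.
    by move: B => B; rewrite !mxE ReM_real mulrC.
  rewrite mulmx_suml retr_sum; apply: eq_bigr => m _.
  rewrite -scalemxAl retrZ mulrC /Gtilde; congr (_ * _).
  by rewrite /B -!mulmxA retrC trmxC_mul /retr !mulmxA.
rewrite (eq_bigr _ (fun k _ => e k)) big_split /= exchange_big /=.
congr (_ + _).
  by apply: eq_bigr => j _; rewrite !mxE mulr_suml.
by rewrite exchange_big /=; apply: eq_bigr => j _; rewrite !mxE mulr_suml.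
Qed.

Lemma usage_feasible (P : 'cV[R]_N) (I : 'cV[R]_M) S :
  primal_feasible G Vb P I S <->
  [/\ forall k, psdmx (S k), forall i, usage S i 0 <= col_mx P I i 0
    & forall k, (\rank (S k) <= n k)%N].
Proof.
split=> [[psS hP hI rS]|[psS hu rS]]; split=> //.
- move=> i; rewrite -(splitK i); case: (fintype.split i) => j /=.
    by rewrite !col_mxEu mxE.
  by rewrite !col_mxEd mxE.
- by move=> j; have := hu (lshift M j); rewrite !col_mxEu mxE.
- by move=> j; have := hu (rshift N j); rewrite !col_mxEd mxE.
Qed.

(* Full row rank provides an input that user [k] receives and all others null. *)
Lemma Htilde_neq0 k : (0 < n k)%N -> row_free (Hstack H) ->
  null_basis (Hbar H k) (Vb k) -> Ht k != 0.
Proof.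
move=> nk /row_freeP [B HB] [_ nb]; apply/eqP => Ht0.
pose u : 'cV[C]_(n k) := const_mx 1.
pose z := dfwith (fun j : 'I_K => 0 : 'cV[C]_(n j)) u.
(* As [B] is a right inverse of the stack, the output of [x] at each user [j] is [z j]. *)
pose x := B *m \mxcol_j z j.
have Hx j : H j *m x = z j.
  have : Hstack H *m x = \mxcol_j z j by rewrite mulmxA HB mul1mx.
  by rewrite /Hstack mxcol_mul => /eq_mxcolP.
have /nb [c xc] : Hbar H k *m x = 0.
  rewrite /Hbar mxcol_mul -mxcol0; apply/eq_mxcolP => j.
  by rewrite Hx /z dfwith_out // neq_lift.
have := Hx k; rewrite /z dfwith_in xc mulmxA -/(Htilde H Vb k) Ht0 mul0mx.
move/matrixP/(_ (Ordinal nk) 0); rewrite !mxE => /eqP.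
by rewrite eq_sym oner_eq0.
Qed.

(** * First-order conditions at a saddle point *)

Variables (P : 'cV[R]_N) (I : 'cV[R]_M) (Ptot : R).
Variables (psi : 'cV[R]_(N + M)) (Q : forall k, 'M[C]_(n k)).
Hypothesis Ptot0 : 0 < Ptot.
Hypothesis sad : saddle_point H G Vb P I Ptot psi Q.

Let dpsi : psi_domain G Vb psi. Proof. by have [[]] := sad. Qed.
Let dQ : Q_domain Q. Proof. by have [_ []] := sad. Qed.
Let pO k : posdefmx (Om psi k). Proof. exact: Omega_pd. Qed.
Let pOF k : posdefmx (Om psi k + F Q k).
Proof. exact: pdDpsd (pO k) (psd_congr (Ht k) (dQ k)). Qed.

(** The gradient of [ftilde psi] in the [k]-th covariance, taken at [Q]. *)
Definition sens k := Ht k *m invmx (Om psi k + F Q k) *m (Ht k)^t*.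

Let psX k : psdmx (sens k).
Proof. exact: psd_congrC (pd_psd (pd_inv (pOF k))). Qed.

(** Minimality along the segment from [psi] to [psi0]. The half-open segment stays in the domain, so
    [psi0] itself may lie outside it. *)
Lemma saddle_psi (psi0 : 'cV[R]_(N + M)) : (forall i, 0 <= psi0 i 0) ->
  ((col_mx P I)^T *m psi0) 0 0 <= Ptot ->
  0 <= \sum_k retr ((invmx (Om psi k + F Q k) - invmx (Om psi k)) *m
                    (Om psi0 k - Om psi k)).
Proof.
move=> psi00 bud0; have [[_ bud] _ _ minpsi] := sad.
pose E k := Om psi0 k - Om psi k.
have hE k : E k \is hermsymmx by apply: hermB (Omega_psd G Vb k psi00).1 (pO k).1.
have OmE t k : Om ((1 - t) *: psi + t *: psi0) k = Om psi k + t%:C *: E k.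
  by rewrite OmegaD rmorphB rmorph1 scalerBl scale1r /E scalerBr addrAC -addrA.
(* The increase of the [k]-th summand along the segment: its first log det is bounded above by the
   tangent, the subtracted one below by [logdet_second_order]. *)
pose f k t := (logdet (Om psi k + t%:C *: E k + F Q k) - logdet (Om psi k + t%:C *: E k)) -
  (logdet (Om psi k + F Q k) - logdet (Om psi k)).
have mix t : 0 <= t < 1 -> psi_domain G Vb ((1 - t) *: psi + t *: psi0).
  by move=> t01; apply: psi_domain_mix.
apply: (quad_ub_ge0 (f := fun t => \sum_k f k t)); last first.
  move=> t t01; have /andP[t0 t1] := t01.
  have := minpsi ((1 - t) *: psi + t *: psi0).
  rewrite (ftildeE H dpsi dQ) (ftildeE H (mix _ t01) dQ) -subr_ge0 -sumrB.
  rewrite (eq_bigr (f^~ t)) => [|k _]; last by rewrite OmE.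
  apply; split; first exact: (mix t t01).
  rewrite mulmxDr -!scalemxAr mxE [X in X + _]mxE [X in _ + X]mxE.
  by apply: convex_comb_le; rewrite ?t0 ?(ltW t1).
apply: quad_ub_sum => k.
have [c [e [c0 e0 le]]] := logdet_second_order (pO k) (hE k).
exists c, (Order.min e 2^-1); split=> //; first by rewrite lt_min e0 invr_gt0 ltr0n.
move=> t /andP[t0]; rewrite le_min => /andP[te t2].
have pOt : posdefmx (Om psi k + t%:C *: E k).
  by rewrite -OmE; apply: Omega_pd; apply: mix; rewrite t0; lra.
have up := logdet_grad (pOF k) (pdDpsd pOt (psd_congr (Ht k) (dQ k))).
have -> : retr ((invmx (Om psi k + F Q k) - invmx (Om psi k)) *m E k) =
  retr (invmx (Om psi k + F Q k) *m E k) - retr (invmx (Om psi k) *m E k).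
  by rewrite mulmxBl retrB.
have lo : logdet (Om psi k) + t * retr (invmx (Om psi k) *m E k) - c * t ^+ 2 <=
  logdet (Om psi k + t%:C *: E k) by apply: le; rewrite t0.
have eD : Om psi k + t%:C *: E k + F Q k - (Om psi k + F Q k) = t%:C *: E k.
  by rewrite opprD addrACA subrr addr0 addrAC subrr add0r.
rewrite eD -scalemxAr retrZ in up.
exact: quad_ubB up lo.
Qed.

(** Maximality along the segment from [Q] to [Q0]: the loss is nonnegative and is bounded above to
    first order through [logdet_second_order]. *)
Lemma saddle_Q (Q0 : forall k, 'M[C]_(n k)) : Q_feasible Ptot Q0 ->
  \sum_k retr (sens k *m Q0 k) <= \sum_k retr (sens k *m Q k).
Proof.
move=> [dQ0 bud0]; have [_ [_ bud] maxQ _] := sad.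
pose E k := (Ht k)^t* *m (Q0 k - Q k) *m Ht k.
have hE k : E k \is hermsymmx by apply/herm_congr/hermB; [have [] := dQ0 k | have [] := dQ k].
pose Qt t k := t%:C *: Q0 k + (1 - t)%:C *: Q k.
have FE t k : Om psi k + F (Qt t) k = Om psi k + F Q k + t%:C *: E k.
  rewrite -addrA; congr (_ + _); rewrite /Qt rmorphB rmorph1 scalerBl scale1r addrCA -scalerBr.
  by rewrite mulmxDr mulmxDl -scalemxAr -scalemxAl.
pose f k t := logdet (Om psi k + F Q k) - logdet (Om psi k + F Q k + t%:C *: E k).
have eE : \sum_k retr (sens k *m Q k) - \sum_k retr (sens k *m Q0 k) =
    \sum_k - retr (invmx (Om psi k + F Q k) *m E k).
  rewrite -sumrB; apply: eq_bigr => k _.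
  have -> : retr (invmx (Om psi k + F Q k) *m E k) = retr (sens k *m (Q0 k - Q k)).
    exact: retr_sandwich.
  by rewrite mulmxBr retrB opprB.
rewrite -subr_ge0 eE.
apply: (quad_ub_ge0 (f := fun t => \sum_k f k t)); last first.
  move=> t /andP[t0 t1]; have t01 : 0 <= t <= 1 by rewrite t0 ltW.
  have dQt := Q_domain_mix t01 dQ0 dQ.
  have := maxQ (Qt t); rewrite (ftildeE H dpsi dQ) (ftildeE H dpsi dQt) -subr_ge0 -sumrB.
  have -> : \sum_k (logdet (Om psi k + F Q k) - logdet (Om psi k) -
      (logdet (Om psi k + F (Qt t) k) - logdet (Om psi k))) = \sum_k f k t.
    by apply: eq_bigr => k _; rewrite /f FE opprB addrA subrK.
  apply; split=> //.
  under eq_bigr => k _ do rewrite -/(retr (Qt t k)) retrD !retrZ.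
  rewrite big_split /= -!mulr_sumr.
  by rewrite addrC; apply: convex_comb_le.
apply: quad_ub_sum => k.
have [c [e [c0 e0 le]]] := logdet_second_order (pOF k) (hE k).
exists c, e; split=> // t te; have := le t te.
exact: quad_ubN.
Qed.

(** By [saddle_Q] the numerator is the maximum of the linearized objective under the power budget;
    the quotient is its value per unit of power. *)
Definition multiplier : R := (\sum_k retr (sens k *m Q k)) / Ptot.
Local Notation mu := multiplier.

Let sum_sens : \sum_k retr (sens k *m Q k) = mu * Ptot.
Proof. by rewrite /mu divfK // gt_eqF. Qed.

Lemma sens_mul_le k (B : 'M[C]_(n k)) : psdmx B ->
  retr (sens k *m B) <= mu * retr B.
Proof.
move=> psB; have [B0|B0] := eqVneq (retr B) 0.
  have := psd_mul_retr_eq0 (pd_psd (pd1 _)) psB; rewrite mul1mx => /(_ B0) ->.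
  by rewrite mulmx0 retr0 mulr0.
have r0 : 0 < retr B by rewrite lt_def B0 psd_retr_ge0.
(* The test family gives the whole power [Ptot] to user [k], in the direction [B]. *)
pose a := Ptot / retr B; have a0 : 0 < a by rewrite divr_gt0.
have fQ0 : Q_feasible Ptot (dfwith (fun j => 0) (a%:C *: B)).
  split=> [j|].
    by case: dfwithP => [|j' _]; [apply: psdZ psB; exact: ltW | exact: psd0].
  rewrite (sum_dfwith _ (g := fun j A => complex.Re (\tr A))) => [|j _].
    by rewrite -/(retr _) retrZ divfK.
  exact: retr0.
have := saddle_Q fQ0; rewrite sum_sens.
rewrite (sum_dfwith _ (g := fun j A => retr (sens j *m A))) => [|j _]; last first.
  by rewrite mulmx0 retr0.
by rewrite -scalemxAr retrZ mulrAC ler_pdivrMr // mulrC -mulrA [Ptot * _]mulrC mulrA ler_pM2r.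
Qed.

(** Test [sens_mul_le] on the rank-one matrices [x x^H]. *)
Lemma sens_le k : psdmx (mu%:C *: 1%:M - sens k).
Proof.
split=> [|x].
  by apply: hermB (psX k).1; apply/hermP; rewrite trmxCZ trmxC1.
have a0 := (pd_psd (pd1 (n k))).2 x; have b0 := (psX k).2 x.
rewrite mulmxBr mulmxBl -scalemxAr -scalemxAl mxE [X in X + _]mxE [X in _ + X]mxE.
rewrite -(ReK a0) -(ReK b0) -(rmorphM (real_complex R)) -(rmorphB (real_complex R)) ler0c subr_ge0.
have := sens_mul_le (gram_psd (x^t*)).
by rewrite retr_qform -[X in mu * retr X]mul1mx retr_qform.
Qed.

(** If the multiplier were [0], the bound at the identity would give [sens k] zero trace; the
    inverse inside is positive definite, so [Ht k] would vanish. *)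
Lemma multiplier_gt0 k : Ht k != 0 -> 0 < mu.
Proof.
move=> Ht0; rewrite lt_def; apply/andP; split; last first.
  by rewrite divr_ge0 ?(ltW Ptot0) // sumr_ge0 // => j _; apply: psd_mul_retr_ge0.
apply: contra_neq Ht0 => mu0; have := sens_mul_le (pd_psd (pd1 (n k))).
rewrite mu0 mul0r mulmx1 => s0; have {}s0 : retr (sens k) = 0.
  by apply/eqP; rewrite eq_le s0 psd_retr_ge0.
pose Z := invmx (Om psi k + F Q k).
have ZHt : Z *m ((Ht k)^t* *m Ht k) = 0.
  apply: psd_mul_retr_eq0 (pd_psd (pd_inv (pOF k))) (gram_psd _) _.
  exact: etrans (retr_gram _ _) s0.
have uO := pd_unit (pOF k).
by apply: gram_eq0; rewrite -[_ *m _](mulKVmx uO) ZHt mulmx0 mxtrace0.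
Qed.

(** The slacks [r j] are nonnegative, while their sum, [mu] times total power minus [Ptot], is at
    most [0]; so each vanishes, and with it the matrix product. *)
Lemma complementarity k : sens k *m Q k = mu%:C *: Q k.
Proof.
pose r j := retr ((mu%:C *: 1%:M - sens j) *m Q j).
have r0 j : 0 <= r j by apply: psd_mul_retr_ge0; [exact: sens_le | exact: dQ].
have mu0 : 0 <= mu.
  by rewrite divr_ge0 ?(ltW Ptot0) // sumr_ge0 // => j _; apply: psd_mul_retr_ge0.
have [_ [_ bud] _ _] := sad.
have sr : \sum_j r j <= 0.
  have -> : \sum_j r j = mu * (\sum_j retr (Q j)) - mu * Ptot.
    rewrite -sum_sens mulr_sumr -sumrB; apply: eq_bigr => j _.
    by rewrite /r mulmxBl retrB -scalemxAl mul1mx retrZ.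
  by rewrite subr_le0; apply: ler_wpM2l.
have rk : r k = 0.
  apply/eqP; rewrite eq_le r0 andbT; apply: le_trans sr.
  by rewrite (bigD1 k) //= lerDl sumr_ge0.
have := psd_mul_retr_eq0 (sens_le k) (dQ k) rk.
by rewrite mulmxBl -scalemxAl mul1mx => /eqP; rewrite subr_eq0 => /eqP.
Qed.

Lemma power_tight : 0 < mu -> \sum_k retr (Q k) = Ptot.
Proof.
move=> mu0; have := sum_sens; under eq_bigr do rewrite complementarity retrZ.
by rewrite -mulr_sumr => /(mulfI (lt0r_neq0 mu0)).
Qed.

(** * Recovery of an optimal solution of the primal problem *)

Hypotheses (P0 : forall j, 0 < P j 0) (I0 : forall m, 0 < I m 0).
Variables (U : forall k, 'M[C]_(n k)) (d : forall k, 'rV[R]_(n k)).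
Variable V : forall k, 'M[C]_(@nbar K N n k, n k).

Local Notation W k := (invmx (sqrtmx (Om psi k))).
Hypothesis svd : forall k, is_svd (Ht k *m W k) (U k) (d k) (V k).
Hypothesis mu0 : 0 < mu.

Let S k := W k *m V k *m (U k)^t* *m Q k *m U k *m (V k)^t* *m W k.

Let hW k : (W k)^t* = W k.
Proof. by rewrite trmxCV; have [[/hermP -> _] _] := sqrtmxP (pO k). Qed.

Let WOW k : W k *m Om psi k *m W k = 1%:M.
Proof.
have [pB BB] := sqrtmxP (pO k); have uB := pd_unit pB.
by rewrite -{2}BB (mulKmx uB) mulmxV.
Qed.

Let sum_S : \sum_k retr (S k *m Om psi k) = Ptot.
Proof.
rewrite -(power_tight mu0); apply: eq_bigr => k _.
exact: retr_user (WOW k) (svd k).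
Qed.

(** By [invB_user] the inequality of [saddle_psi] reads [0 <= mu (Ptot - cost)], where the cost is
    that of [S] at the prices [psi0]. *)
Lemma usage_dot (psi0 : 'cV[R]_(N + M)) : (forall i, 0 <= psi0 i 0) ->
  ((col_mx P I)^T *m psi0) 0 0 <= Ptot -> ((usage S)^T *m psi0) 0 0 <= Ptot.
Proof.
move=> psi00 bud0; rewrite -usageE -sum_S -subr_ge0 -sumrB.
have := saddle_psi psi00 bud0.
have -> : \sum_k retr ((invmx (Om psi k + F Q k) - invmx (Om psi k)) *m
      (Om psi0 k - Om psi k)) =
    mu * \sum_k (retr (S k *m Om psi k) - retr (S k *m Om psi0 k)).
  rewrite mulr_sumr; apply: eq_bigr => k _; apply: retr_mulB.
  exact: invB_user (hW k) (WOW k) (svd k) (dQ k) mu0 (complementarity k).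
by rewrite pmulr_rge0.
Qed.

Lemma saddle_primal_feasible : primal_feasible G Vb P I S.
Proof.
apply/usage_feasible; split=> [k|i|k]; last exact: rank_user.
  exact: psd_user (hW k) (dQ k).
have p0 : 0 < col_mx P I i 0.
  by rewrite -(splitK i); case: (fintype.split i) => j /=; rewrite ?col_mxEu ?col_mxEd.
(* All of the budget [Ptot] goes to the price of resource [i], so [usage_dot] isolates the [i]-th
   constraint. *)
pose psi0 : 'cV[R]_(N + M) := (Ptot / col_mx P I i 0) *: delta_mx i 0.
have dot (v : 'cV[R]_(N + M)) : (v^T *m psi0) 0 0 = Ptot / col_mx P I i 0 * v i 0.
  by rewrite -scalemxAr -colE !mxE.
have := usage_dot (psi0 := psi0); rewrite !dot divfK ?gt_eqF // lexx.
rewrite mulrAC ler_pdivrMr // ler_pM2l //; apply=> // j.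
by rewrite mxE [delta_mx _ _ _ _]mxE mulr_ge0 ?ler0n //; apply: divr_ge0; exact: ltW.
Qed.

(** Summing the single-user dual bounds, the gain of [S'] over [S] is at most [mu] times its cost at
    [psi] minus [Ptot]; feasibility of [S'] and of [psi] makes this nonpositive. *)
Lemma saddle_primal_optimal : primal_optimal H G Vb P I S.
Proof.
split; first exact: saddle_primal_feasible.
move=> S' /usage_feasible [psS' uS' _]; have [[[psi0 _] bud] _ _ _] := sad.
have dual k := duality_user (hW k) (WOW k) (svd k) (dQ k) mu0 (complementarity k)
  (sens_le k) (psS' k).
apply: le_trans (ler_sum _ (fun k _ => dual k)) _.
rewrite big_split /= gerDl -mulr_sumr pmulr_rle0 // sumrB usageE (power_tight mu0).
rewrite subr_le0; apply: le_trans bud; rewrite !mxE; apply: ler_sum => i _.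
by rewrite mxE [X in _ <= X * _]mxE ler_wpM2r.
Qed.

End Saddle.

Theorem theorem1 (R : realType) (K M N : nat)
    (n : 'I_K -> nat) (nt : 'I_M -> nat)
    (H : forall k : 'I_K, 'M[R[i]]_(n k, N))
    (G : forall m : 'I_M, 'M[R[i]]_(nt m, N))
    (P : 'cV[R]_N) (I : 'cV[R]_M) (Ptot : R)
    (Vb : forall k : 'I_K, 'M[R[i]]_(N, @nbar K N n k)) :
  (0 < K)%N -> (0 < M)%N -> (0 < N)%N ->
  (forall k, (0 < n k)%N) -> (forall m, (0 < nt m)%N) ->
  (forall j, 0 < P j 0) -> (forall m, 0 < I m 0) -> 0 < Ptot ->
  row_free (Hstack H) ->
  (forall k, null_basis (Hbar H k) (Vb k)) ->
  [/\ forall Q : forall k, 'M[R[i]]_(n k), Q_domain Q ->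
        convex_set (psi_domain G Vb) /\
        convex_function (psi_domain G Vb) (fun psi => ftilde H G Vb psi Q),
      forall psi : 'cV[R]_(N + M), psi_domain G Vb psi ->
        concave_family Q_domain (ftilde H G Vb psi)
    & forall (psi : 'cV[R]_(N + M)) (Q : forall k, 'M[R[i]]_(n k))
        (U : forall k, 'M[R[i]]_(n k)) (d : forall k, 'rV[R]_(n k))
        (V : forall k, 'M[R[i]]_(@nbar K N n k, n k)),
      saddle_point H G Vb P I Ptot psi Q ->
      let W k := invmx (sqrtmx (Omega G Vb psi k)) in
      (forall k, is_svd (Htilde H Vb k *m W k) (U k) (d k) (V k)) ->
      primal_optimal H G Vb P I
        (fun k => W k *m V k *m (U k)^t* *m Q k *m U k *m (V k)^t* *m W k)].
Proof.
move=> K0 _ _ n0 _ P0 I0 Pt0 free nb; split.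
- move=> Q dQ; split.
  + move=> x y t /set_mem dx /set_mem dy; apply/mem_set.
    by apply: psi_domain_convex dx dy; rewrite ge0 le1.
  + move=> t x y /set_mem dx /set_mem dy; rewrite convRE.
    by apply: ftilde_convex dx dy dQ; rewrite ge0 le1.
- move=> psi dpsi t Q Q' t01 dQ dQ'; split; first exact: Q_domain_mix.
  exact: ftilde_concave.
- move=> psi Q U d V sad W svd; pose k0 := Ordinal K0.
  (* One user with a nonzero effective channel suffices, and [0 < K] provides [k0]. *)
  have mu0 := multiplier_gt0 Pt0 sad (Htilde_neq0 (n0 k0) free (nb k0)).
  by have := saddle_primal_optimal Pt0 sad P0 I0 svd mu0.
Qed.
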